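(* Let $k>\log 2$ be a real number. Then there exists a positive number $c$, depending only on $k$, such that for every positive integer $a$ that is either equal to $1$ or not a perfect power of any rational number, every integer $N\ge 1$, and every algebraic integer $\beta\in\mathbb{Q}_a(N)$ with $M_{a,N}(\beta)\notin\{0,1\}$, $$\Delta_a(N)^2\,H(\beta)^2\;\ge\; c\,M_{a,N}(\beta)\,\exp\!\left(-\frac{k\log M_{a,N}(\beta)}{\log\log M_{a,N}(\beta)}\right),$$ where $H(\beta)$ denotes the house of $\beta$, i.e. the maximum of the absolute values of the conjugates of $\beta$ over $\mathbb{Q}$.
   Context: For an integer $N\ge1$, $\mathbb{Q}_a(N)=\mathbb{Q}(\zeta_N,\sqrt[N]{a})\subset\mathbb{C}$ is the field obtained by adjoining to $\mathbb{Q}$ all roots of $X^N-a$; $\zeta_N$ is a primitive $N$-th root of unity, $\zeta_m=\zeta_N^{N/m}$ for $m\mid N$, and $\sqrt[m]{a}$ is the positive real $m$-th root. ''Not a perfect power'' means $a\neq b^m$ for all rational $b$ and integers $m\ge2$. For a finite extension $L/K$ of number fields and a finite family $(x_u)$ in $L$, $\mathrm{disc}_{L/K}(\{x_u\})=\det(\mathrm{Tr}_{L/K}(x_ux_v))_{u,v}$. Let $N=p_1^{e_1}\cdots p_s^{e_s}$ with primes $p_1<\dots<p_s$. Define $$\Delta_a(N)=\left|\mathrm{Nm}_{\mathbb{Q}_a(N)/\mathbb{Q}}\left(\prod_{i=1}^{s}\prod_{t=1}^{e_i}\mathrm{disc}_{\mathbb{Q}_a(p_1^{e_1}\cdots p_{i-1}^{e_{i-1}}p_i^{t})/\mathbb{Q}_a(p_1^{e_1}\cdots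 p_{i-1}^{e_{i-1}}p_i^{t-1})}\left(\{\zeta_{p_i^t}^{l}\sqrt[p_i^t]{a^{k}}\}_{l,k}\right)\right)\right|,$$ where $0\le k\le p_i-1$, and $0\le l\le p_i-2$ if $t=1$, $0\le l\le p_i-1$ if $t\ge2$ (here $k$ is an index, unrelated to the real number $k$ of the claim). An empty product is $1$. If $a=1$, the convention is that $\Delta_a(N)$ is replaced by $1$. For an algebraic integer $\beta\in\mathbb{Q}_a(N)$, $M_{a,N}(\beta)$ is the least number of summands (counted with repetition) in a representation of $\Delta_a(N)\beta$ as a finite sum of terms $\xi\alpha$, where $\xi$ is a root of unity and $\alpha=\sqrt[N]{a^j}$ is a positive real number with $0\le j\le N-1$. (The empty sum represents $0$.) *)

(* Defs.v *)
From HB Require Import structures.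
From mathcomp Require Import all_boot all_order all_algebra.
From mathcomp Require Import complex.
From mathcomp Require Import all_classical all_reals all_analysis.

Set Implicit Arguments.
Unset Strict Implicit.
Unset Printing Implicit Defensive.

Import Order.TTheory GRing.Theory Num.Theory.
Local Open Scope classical_set_scope.
Local Open Scope ring_scope.

(* Number fields are subfields of the complex numbers R[i], represented as    *)
(* sets. In a field, [divring_closed] (containing 1, closed under subtraction *)
(* and division) means being a subfield.                                      *)

Definition Qfield (R : realType) : set R[i] := range (ratr : rat -> R[i]).
Arguments Qfield : clear implicits.

Definition Qa (R : realType) (a m : nat) : set R[i] :=
  smallest (fun K : set R[i] => GRing.divring_closed (fun x : R[i] => x \in K))
           [set x | root ('X^m - (a%:R)%:P) x].
Arguments Qa : clear implicits.

Definition is_basis (R : realType) (K L : set R[i]) (n : nat) (b : 'cV[R[i]]_n) :=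
  (forall i, L (b i 0)) /\
  (forall x, L x ->
     exists! c : 'rV[R[i]]_n, (forall i, K (c 0 i)) /\ x = \sum_(i < n) c 0 i * b i 0).

Definition is_mult_matrix (R : realType) (K L : set R[i]) (x : R[i])
    (n : nat) (A : 'M[R[i]]_n) :=
  exists b : 'cV[R[i]]_n,
    [/\ is_basis K L b, (forall i j, K (A i j)) & x *: b = A *m b].

(* Trace and norm of the K-linear map "multiplication by x" on L. They do not *)
(* depend on the basis, so [xget] selects the only element of the set (and 0  *)
(* if L is not a finite extension of K containing x).                         *)
Definition field_trace (R : realType) (K L : set R[i]) (x : R[i]) : R[i] :=
  xget 0 [set t | exists n (A : 'M[R[i]]_n), is_mult_matrix K L x A /\ t = \tr A].

Definition field_norm (R : realType) (K L : set R[i]) (x : R[i]) : R[i] :=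
  xget 0 [set t | exists n (A : 'M[R[i]]_n), is_mult_matrix K L x A /\ t = \det A].

Definition disc (R : realType) (K L : set R[i]) (I : finType) (x : I -> R[i]) : R[i] :=
  \det (\matrix_(u < #|I|, v < #|I|)
          field_trace K L (x (enum_val u) * x (enum_val v))).

(* The product p_1^{e_1} ... p_{i-1}^{e_{i-1}}, where p = p_i. *)
Definition lower_part (N p : nat) : nat :=
  (\prod_(q <- primes N | q < p) q ^ logn q N)%N.

(* [z] stands for zeta_N. For a positive real x, [m.-root x] is the positive  *)
(* real m-th root of x. The index (l, k) has l <= p - 2 if t = 1, l <= p - 1  *)
(* if t >= 2, and k <= p - 1.                                                 *)
Definition step_family (R : realType) (a N : nat) (z : R[i]) (p t : nat)
    (lk : 'I_(if t == 1%N then p.-1 else p) * 'I_p) : R[i] :=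
  (z ^+ (N %/ p ^ t)) ^+ lk.1 * (p ^ t).-root (a%:R ^+ lk.2).

Definition step_disc (R : realType) (a N : nat) (z : R[i]) (p t : nat) : R[i] :=
  disc (Qa R a (lower_part N p * p ^ t.-1)) (Qa R a (lower_part N p * p ^ t))
       (@step_family R a N z p t).

Definition Delta (R : realType) (a N : nat) (z : R[i]) : R :=
  if a == 1%N then 1
  else Normc.normc (field_norm (Qfield R) (Qa R a N)
         (\prod_(p <- primes N) \prod_(1 <= t < (logn p N).+1) step_disc a N z p t)).

Definition algebraic_integer (R : realType) (x : R[i]) :=
  integralOver (intr : int -> R[i]) x.

Definition is_root_of_unity (R : realType) (x : R[i]) :=
  exists2 m, (0 < m)%N & m.-unity_root x.

Definition sum_of_terms (R : realType) (a N : nat) (x : R[i]) (n : nat) :=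
  exists (xi : 'I_n -> R[i]) (j : 'I_n -> 'I_N),
    (forall i, is_root_of_unity (xi i)) /\
    x = \sum_(i < n) xi i * N.-root (a%:R ^+ j i).

(* The least n such that Delta_a(N) * beta is a sum of n terms. *)
Definition Mlength (R : realType) (a N : nat) (z beta : R[i]) : nat :=
  xget 0%N [set n | sum_of_terms a N ((Delta a N z)%:C%C * beta) n /\
    forall m, sum_of_terms a N ((Delta a N z)%:C%C * beta) m -> (n <= m)%N].

(* The conjugates of x over the rationals: the roots of its minimal polynomial. *)
Definition conjugates (R : realType) (x : R[i]) : set R[i] :=
  [set y | exists p : {poly rat},
     [/\ p \is monic, irreducible_poly p, root (map_poly ratr p) x
       & root (map_poly ratr p) y]].

Definition house (R : realType) (x : R[i]) : R :=
  sup [set Normc.normc y | y in conjugates x].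

Definition not_perfect_power (a : nat) :=
  forall (b : rat) (m : nat), (2 <= m)%N -> a%:R <> b ^+ m.

(* Main.v *)
Require Import Defs.
From HB Require Import structures.
From mathcomp Require Import all_boot all_order all_algebra.
From mathcomp Require Import cyclic separable fieldext algC cyclotomic.
From mathcomp Require Import complex.
From mathcomp Require Import all_classical all_reals all_analysis.
From mathcomp Require Import zify lra ring finset.

Set Implicit Arguments.
Unset Strict Implicit.
Unset Printing Implicit Defensive.

Import Order.TTheory GRing.Theory Num.Theory.
Local Open Scope ring_scope.

(* Write gamma = Delta beta. When its length M is positive, gamma is by       *)
(* definition a sum of terms xi a^(j/N), and Delta is a positive rational, so *)
(* it suffices to bound the mean square of the conjugates of gamma from below.*)
(* Let w be a root of unity of order n divisible by 8aN and by the orders of  *)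
(* the xi. Then sqrt a lies in Z[w], and by Kummer theory a^(1/N) has degree  *)
(* d over Q(w), where a^(d/N) is 1, sqrt a or a. Hence                        *)
(* gamma = sum_{j<d} P_j(w) a^(j/N), and averaging over a^(1/N) -> z a^(1/N), *)
(* z^d = 1, bounds the mean square by the sum of those of the P_j(w).         *)
(* For x in Z[w], strip one prime p off n at a time, as Cassels and Loxton    *)
(* do: x = sum_{l<p} e^l x_l with e a power of w and x_l in Z[w^p]. If p^2    *)
(* divides n, mean squares add up; otherwise the mean square of x is          *)
(* (p-1)^-1 sum_{i<j} of those of x_i - x_j, while the length of x is at most *)
(* sum_i length (x_i - x_j) for every j. For the target m^(1-eta),            *)
(* eta = k'/log Y, this always costs a factor at most 2, and no factor at all *)
(* if p >= Y, because length (x_i - x_j) is a metric. So the mean square is   *)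
(* at least 2^-Y M^(1-eta), and Y about (log M)^s, with s < 1, proves the     *)
(* theorem.                                                                   *)

(** * A metric inequality *)

Definition metric_bound (F : numDomainType) (h : nat -> F) (p : nat) :=
  forall (n : nat) (d : 'I_p -> 'I_p -> nat),
    (forall i j, d i j = d j i) -> (forall i j k, d i k <= d i j + d j k)%N ->
    (forall j, n <= \sum_i d i j)%N ->
    2 * (p%:R - 1) * h n <= \sum_j \sum_i h (d i j).

Lemma sum_large_ge (R : realFieldType) (I : finType) (S : {set I})
    (gam : R) (u f : I -> R) :
  0 <= gam ->
  (forall i, 0 <= u i) -> (forall i, Num.min (u i) 1 <= f i) ->
  (forall i, i \in S -> Num.min (u i) 2^-1 + gam <= f i) -> S != set0 ->
  Num.min (\sum_(i in S) u i) 1 + (#|S|%:R - 1) * gam <= \sum_(i in S) f i.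
Proof.
move=> gam0 u0 f1 fS /set0Pn[j0 j0S].
have [i1 i1S max1] : exists2 i1, i1 \in S & forall i, i \in S -> u i <= u i1.
  by case: (@Order.TotalTheory.arg_maxP _ _ _ j0 (mem S) u j0S) => i1 iS h; exists i1.
have cardS : #|S|%:R - 1 = #|S :\ i1|%:R :> R.
  by rewrite (cardsD1 i1 S) i1S natrD addrAC subrr add0r.
have sumD1 (F : I -> R) : \sum_(i in S) F i = F i1 + \sum_(i in S :\ i1) F i.
  by rewrite (big_setD1 i1).
rewrite cardS mulr_natl -sumr_const !sumD1.
have [small|] := boolP [forall i in S :\ i1, u i <= 2^-1].
  have : \sum_(i in S :\ i1) (u i + gam) <= \sum_(i in S :\ i1) f i.
    apply: ler_sum => i iS1; apply: le_trans (fS i _); last by case/setD1P: iS1.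
    by have /forall_inP/(_ _ iS1) h := small; rewrite min_l.
  rewrite big_split /=; have := f1 i1.
  have : 0 <= \sum_(i in S :\ i1) u i by apply: sumr_ge0.
  rewrite !minEle; case: ifP; case: ifP; lra.
rewrite negb_forall_in => /exists_inP[i2 i2S]; rewrite -ltNge => big2.
rewrite (big_setD1 i2 (A := S :\ i1)) //= [X in _ <= _ + X](big_setD1 i2) //=.
rewrite [X in _ + X <= _](big_setD1 i2) //=.
have i2S' : i2 \in S by case/setD1P: i2S.
have : \sum_(i in S :\ i1 :\ i2) gam <= \sum_(i in S :\ i1 :\ i2) f i.
  apply: ler_sum => i /setD1P[_ /setD1P[_ iS]]; apply: le_trans (fS i iS).
  by rewrite lerDr le_min u0 invr_ge0 ler0n.
have := fS _ i2S'; rewrite min_r ?(ltW big2) //.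
have := f1 i1; have := max1 _ i2S'.
rewrite !minEle; case: ifP; case: ifP; lra.
Qed.

Lemma sum_concave_pseudometric (R : realFieldType) (p : nat) (phi : R -> R)
    (B tau : R) (x : 'I_p -> 'I_p -> R) :
  (0 < p)%N -> 2 <= B -> 2 * p%:R - 2 <= (p%:R - 2) * B -> 0 <= tau ->
  (forall t u, 0 <= t -> t <= u -> phi t <= phi u) ->
  (forall t u, 0 <= t -> 0 <= u -> phi (t + u) <= phi t + phi u) ->
  (forall t, 0 <= t -> Num.min t 1 <= phi t) ->
  (forall t, 0 <= t -> t <= tau -> B * t <= phi t) ->
  (forall t, tau < t -> Num.min t 2^-1 + 3 / p%:R <= phi t) ->
  (forall i j, 0 <= x i j) -> (forall i j, x i j = x j i) ->
  (forall i j k, x i k <= x i j + x j k) ->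
  (forall j, 1 <= \sum_i x i j) ->
  2 * (p%:R - 1) <= \sum_j \sum_i phi (x i j).
Proof.
move=> p0 B2 pB tau0 phi_mono phi_sub phi1 phi_small phi_large x0 xC xtri xsum.
pose T j := \sum_i phi (x i j).
have [i0 minT] : exists i0, forall i, T i0 <= T i.
  by case: (@Order.TotalTheory.arg_minP _ _ _ (Ordinal p0) predT T isT) => i _ h;
     exists i => j; exact: h.
pose f i := phi (x i i0); pose S := [set i | tau < x i i0].
have f0 i : 0 <= f i.
  by apply: le_trans (phi1 _ (x0 _ _)); rewrite le_min x0 ler01.
(* Row [i0] has the least sum; points far from [i0] have much larger row sums. *)
have T_ge i : p%:R * f i - T i0 <= T i.
  have -> : p%:R * f i = \sum_(k < p) f i by rewrite sumr_const card_ord mulr_natl.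
  rewrite -sumrB; apply: ler_sum => k _; rewrite lerBlDr [x k i]xC.
  exact: le_trans (phi_mono _ _ (x0 _ _) (xtri i k i0)) (phi_sub _ _ (x0 _ _) (x0 _ _)).
have p_gt0 : 0 < p%:R :> R by rewrite ltr0n.
have sumT : p%:R * T i0 <= \sum_j T j.
  rewrite mulr_natl; have -> : T i0 *+ p = \sum_(k < p) T i0 by rewrite sumr_const card_ord.
  by apply: ler_sum.
have [T2|/ltW T2] := leP 2 (T i0).
  by apply: le_trans sumT; rewrite mulrC; nra.
pose s := #|S|; pose U := \sum_(i in S) f i; pose V := \sum_(i in ~: S) f i.
pose A := \sum_(i in S) x i i0.
have splitS (F : 'I_p -> R) : \sum_i F i = \sum_(i in S) F i + \sum_(i in ~: S) F i.
  rewrite (bigID (mem S)) /=; congr (_ + _).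
  by apply: eq_bigl => i; rewrite in_setC.
have TUV : T i0 = U + V by rewrite /T splitS.
have sumT' : p%:R * U + (p%:R - 2 * s%:R) * (U + V) <= \sum_j T j.
  have -> : p%:R * U + (p%:R - 2 * s%:R) * (U + V) =
      \sum_(i in S) (p%:R * f i - T i0) + \sum_(i in ~: S) T i0.
    rewrite sumrB -mulr_sumr !sumr_const -TUV (cardsCs (~: S)) setCK card_ord -/s.
    have sp : (s <= p)%N by rewrite -[p in (_ <= p)%N]card_ord; exact: max_card.
    rewrite -!(mulr_natl (T i0)) natrB // -/U; ring.
  by rewrite [leRHS]splitS lerD // ler_sum.
have V0 : 0 <= V by apply: sumr_ge0.
have A0 : 0 <= A by apply: sumr_ge0.
have VB : B * (1 - A) <= V.
  apply: (@le_trans _ _ (\sum_(i in ~: S) B * x i i0)).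
    rewrite -mulr_sumr ler_pM2l; last by apply: lt_le_trans B2; rewrite ltr0n.
    by rewrite lerBlDl -splitS.
  by apply: ler_sum => i; rewrite !inE -leNgt => h; apply: phi_small.
apply: le_trans sumT'.
have [S0|Sn0] := eqVneq S set0.
  have s0 : s = 0%N by rewrite /s S0 cards0.
  have a0 : A = 0 by rewrite /A S0 big_set0.
  have u0 : U = 0 by rewrite /U S0 big_set0.
  move: VB; rewrite s0 a0 u0; nra.
have s1 : (0 < s)%N by rewrite card_gt0.
have gam0 : 0 <= 3 / p%:R :> R by rewrite divr_ge0 ?ler0n.
have := @sum_large_ge R _ S (3 / p%:R) (fun i => x i i0) f gam0 (fun i => x0 _ _)
   (fun i => phi1 _ (x0 _ _)).
have fS i : i \in S -> Num.min (x i i0) 2^-1 + 3 / p%:R <= f i.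
  by rewrite inE; apply: phi_large.
move=> /(_ fS Sn0); rewrite -/U -/A -/s => HU.
set m := Num.min A 1 in HU.
have m1 : m <= 1 by rewrite ge_min lexx orbT.
have Vm : B * (1 - m) <= V by rewrite /m minEle; case: ifP => // _; rewrite subrr mulr0.
have [s_1|s_n1] := eqVneq s 1%N.
  move: HU; rewrite s_1 subrr mul0r addr0 => HU.
  have p1 : 1 <= p%:R :> R by rewrite ler1n.
  have [p2|p2] := leP 2 (p%:R : R).
    have : (p%:R - 2) * (B * (1 - m)) <= (p%:R - 2) * V by rewrite ler_wpM2l // subr_ge0.
    nra.
  nra.
have s2 : 2 <= s%:R :> R by rewrite ler_nat ltn_neqAle eq_sym s_n1.
have HU' : p%:R * m + 3 * (s%:R - 1) <= p%:R * U.
  have -> : p%:R * m + 3 * (s%:R - 1) = p%:R * (m + (s%:R - 1) * (3 / p%:R)).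
    by field; rewrite gt_eqF.
  by rewrite ler_wpM2l // ltW.
have V2 : p%:R * (2 * (1 - m)) <= p%:R * V.
  rewrite ler_wpM2l ?(ltW p_gt0) //; apply: le_trans Vm.
  by rewrite ler_wpM2r // subr_ge0.
have : s%:R * (U + V) <= s%:R * 2 by rewrite ler_wpM2l ?ler0n // -TUV.
nra.
Qed.

(** * Sums of roots of unity *)

Definition root1 (C : numClosedFieldType) (x : C) := exists2 m, (0 < m)%N & x ^+ m = 1.

Definition root1_sum (C : numClosedFieldType) (x : C) (n : nat) :=
  exists s : seq C,
    [/\ size s = n, forall y, y \in s -> root1 y & x = \sum_(y <- s) y].

Definition root1_length (C : numClosedFieldType) (x : C) : nat :=
  xget 0%N [set n | root1_sum x n /\ forall m, root1_sum x m -> (n <= m)%N]%classic.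

Section Root1.
Variable C : numClosedFieldType.
Implicit Types (x y z : C) (n m : nat).

Lemma root1_1 : root1 (1 : C).
Proof. by exists 1%N. Qed.

Lemma root1M x y : root1 x -> root1 y -> root1 (x * y).
Proof.
move=> [m m0 xm] [n n0 yn]; exists (m * n)%N; first by rewrite muln_gt0 m0.
by rewrite exprMn exprM xm [(m * n)%N]mulnC exprM yn !expr1n mulr1.
Qed.

Lemma root1X x n : root1 x -> root1 (x ^+ n).
Proof. by move=> [m m0 xm]; exists m => //; rewrite exprAC xm expr1n. Qed.

Lemma root1N x : root1 x -> root1 (- x).
Proof.
rewrite -mulN1r; apply: root1M; exists 2%N => //; by rewrite sqrrN expr1n.
Qed.

Lemma root1_norm x : root1 x -> `|x| = 1.
Proof.
move=> [m m0 xm]; apply/eqP; rewrite -(@pexpr_eq1 _ _ m) //.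
by rewrite -normrX xm normr1.
Qed.

Lemma root1_prim n z : n.-primitive_root z -> root1 z.
Proof. by move=> pz; exists n; [exact: prim_order_gt0 pz | exact: prim_expr_order]. Qed.

Lemma root1_sum0 : root1_sum (0 : C) 0.
Proof. by exists [::]; split=> //; rewrite big_nil. Qed.

Lemma root1_sum_root1 x : root1 x -> root1_sum x 1.
Proof.
by move=> hx; exists [:: x]; split=> [||] //; [move=> y; rewrite inE => /eqP-> | rewrite big_seq1].
Qed.

Lemma root1_sumD x y n m :
  root1_sum x n -> root1_sum y m -> root1_sum (x + y) (n + m).
Proof.
move=> [s [<- hs ->]] [t [<- ht ->]]; exists (s ++ t); split; first by rewrite size_cat.
  by move=> z; rewrite mem_cat => /orP[/hs|/ht].
by rewrite big_cat.
Qed.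

Lemma root1_sumM z x n : root1 z -> root1_sum x n -> root1_sum (z * x) n.
Proof.
move=> hz [s [<- hs ->]]; exists [seq z * y | y <- s]; split; first by rewrite size_map.
  by move=> y /mapP[u us ->]; apply: root1M => //; exact: hs.
by rewrite big_map mulr_sumr.
Qed.

Lemma root1_sum_big (I : finType) (P : pred I) (F : I -> C) (d : I -> nat) :
  (forall i, P i -> root1_sum (F i) (d i)) ->
  root1_sum (\sum_(i | P i) F i) (\sum_(i | P i) d i)%N.
Proof.
move=> h; elim/big_rec2: _ => [|i x n Pi]; first exact: root1_sum0.
by move=> hxn; rewrite addrC addnC; apply: root1_sumD => //; exact: h.
Qed.

Lemma root1_lengthP x n : root1_sum x n ->
  root1_sum x (root1_length x) /\ (root1_length x <= n)%N.
Proof.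
move=> xn; have ex : exists n, `[< root1_sum x n >] by exists n; exact/asboolP.
rewrite /root1_length; case: xgetP => [k _ [/= xk kmin]|none]; first by split; auto.
case: (ex_minnP ex) => k /asboolP xk kmin.
by case: (none k); split=> // m xm; apply: kmin; exact/asboolP.
Qed.

Definition root1_gen x := exists n, root1_sum x n.

Lemma root1_gen_length x : root1_gen x -> root1_sum x (root1_length x).
Proof. by move=> [n /root1_lengthP[]]. Qed.

Lemma root1_genD x y : root1_gen x -> root1_gen y -> root1_gen (x + y).
Proof. by move=> [n hn] [m hm]; exists (n + m)%N; exact: root1_sumD. Qed.

Lemma root1_genN x : root1_gen x -> root1_gen (- x).
Proof.
move=> [n hn]; exists n; rewrite -mulN1r; apply: root1_sumM => //.
exact/root1N/root1_1.
Qed.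

Lemma root1_genM x y : root1_gen x -> root1_gen y -> root1_gen (x * y).
Proof.
move=> [n [s [_ hs ->]]] [m hy]; rewrite mulr_suml big_seq.
elim/big_ind: _ => [|u v|u us]; [by exists 0%N; exact: root1_sum0 | exact: root1_genD |].
by exists m; apply: root1_sumM => //; exact: hs.
Qed.

Lemma root1_gen_sum (I : finType) (P : pred I) (F : I -> C) :
  (forall i, P i -> root1_gen (F i)) -> root1_gen (\sum_(i | P i) F i).
Proof.
move=> h; elim/big_ind: _ => //; last exact: root1_genD.
by exists 0%N; exact: root1_sum0.
Qed.

Lemma root1_length_sum (I : finType) (F z : I -> C) :
  (forall i, root1 (z i)) -> (forall i, root1_gen (F i)) ->
  (root1_length (\sum_i z i * F i) <= \sum_i root1_length (F i))%N.
Proof.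
move=> hz hF; apply: (fun H => proj2 (root1_lengthP H)).
by apply: root1_sum_big => i _; apply: root1_sumM => //; exact: root1_gen_length.
Qed.

Lemma root1_lengthD x y : root1_gen x -> root1_gen y ->
  (root1_length (x + y) <= root1_length x + root1_length y)%N.
Proof.
move=> hx hy; apply: (fun H => proj2 (root1_lengthP H)).
by apply: root1_sumD; exact: root1_gen_length.
Qed.

Lemma root1_lengthN x : root1_gen x -> root1_length (- x) = root1_length x.
Proof.
suff le y : root1_gen y -> (root1_length (- y) <= root1_length y)%N.
  move=> hx; apply/eqP; rewrite eqn_leq le //= -{1}[x]opprK le //; exact: root1_genN.
move=> hy; apply: (fun H => proj2 (root1_lengthP H)); rewrite -mulN1r.
by apply: root1_sumM; [exact/root1N/root1_1 | exact: root1_gen_length].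
Qed.

Lemma root1_sum_int (c : int) : root1_sum (c%:~R : C) `|c|%N.
Proof.
suff nat_sum n : root1_sum (n%:R : C) n.
  case: c => n; first exact: nat_sum.
  rewrite NegzE mulrNz -mulN1r; apply: root1_sumM; last exact: nat_sum.
  exact/root1N/root1_1.
elim: n => [|n ih]; first exact: root1_sum0.
rewrite -natr1 -addn1; apply: root1_sumD => //.
exact/root1_sum_root1/root1_1.
Qed.

Lemma root1_gen_horner (P : {poly int}) x : root1 x -> root1_gen (map_poly intr P).[x].
Proof.
move=> hx; rewrite horner_coef; apply: root1_gen_sum => i _.
apply: root1_genM; first by rewrite coef_map; eexists; exact: root1_sum_int.
by eexists; apply: root1_sum_root1; exact: root1X.
Qed.

Lemma sum_expr_root1 n x : x ^+ n = 1 -> x != 1 -> \sum_(t < n) x ^+ t = 0.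
Proof.
move=> xn xn1; have := subrX1 x n; rewrite xn subrr => /esym/eqP.
by rewrite mulf_eq0 subr_eq0 (negbTE xn1) => /eqP.
Qed.

Lemma parseval n (z : C) (a : 'I_n -> C) : n.-primitive_root z ->
  \sum_(t < n) `|\sum_(l < n) (z ^+ t) ^+ l * a l| ^+ 2 =
  n%:R * \sum_(l < n) `|a l| ^+ 2.
Proof.
move=> pz; have z1 := root1_norm (root1_prim pz).
have z0 : z != 0 by rewrite -normr_eq0 z1 oner_eq0.
have zJ : z^* = z^-1 by rewrite invC_norm z1 expr1n invr1 mul1r.
under eq_bigr => t _.
  rewrite normCK rmorph_sum mulr_suml.
  under eq_bigr => i _ do rewrite mulr_sumr.
  over.
rewrite exchange_big mulr_sumr; apply: eq_bigr => i _ /=.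
rewrite exchange_big /= (bigD1 i) //= [X in _ + X]big1 ?addr0; last first.
  move=> j ji.
  under eq_bigr => t _.
    rewrite rmorphM !rmorphXn /= zJ !exprVn mulrACA -!exprM ![(t * _)%N]mulnC !exprM.
    rewrite -exprVn -exprMn; over.
  rewrite -mulr_suml sum_expr_root1 ?mul0r //.
    by rewrite exprMn exprVn exprAC [in X in _ / X]exprAC (prim_expr_order pz) !expr1n divr1.
  apply/negP => /eqP /divr1_eq /eqP; rewrite (eq_prim_root_expr pz).
  by rewrite !modn_small // => /eqP/val_inj ij; rewrite ij eqxx in ji.
under eq_bigr => t _.
  rewrite -normCK normrM !normrX z1 !expr1n mul1r; over.
by rewrite sumr_const card_ord mulr_natl.
Qed.

Lemma variance n (a : 'I_n -> C) :
  \sum_(i < n) \sum_(j < n) `|a i - a j| ^+ 2 =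
  2 * (n%:R * \sum_(l < n) `|a l| ^+ 2 - `|\sum_(l < n) a l| ^+ 2).
Proof.
pose S := \sum_(l < n) a l; pose Q := \sum_(l < n) `|a l| ^+ 2.
have row i : \sum_(j < n) `|a i - a j| ^+ 2 =
    n%:R * `|a i| ^+ 2 + Q - (a i * S^* + (a i)^* * S).
  rewrite /S rmorph_sum !mulr_sumr -big_split /= -[n in n%:R]card_ord mulr_natl.
  rewrite -sumr_const -big_split -sumrB; apply: eq_bigr => j _ /=.
  by rewrite !normCK rmorphB; ring.
rewrite (eq_bigr _ (fun i _ => row i)) sumrB !big_split /= -!mulr_suml -mulr_sumr.
rewrite sumr_const card_ord -rmorph_sum -/S -/Q normCK -mulr_natl; ring.
Qed.
End Root1.

(** * Mean squares of cyclotomic conjugates *)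

Lemma sum_ord_mul (V : nmodType) (p m : nat) (F : nat -> V) :
  \sum_(r < p * m) F r = \sum_(i < m) \sum_(t < p) F (i + m * t)%N.
Proof.
rewrite exchange_big /= -(big_mkord xpredT).
elim: p => [|p ih]; first by rewrite big_ord0 big_geq.
rewrite big_ord_recr /= -ih mulSn addnC (@big_cat_nat _ _ _ (p * m)) //= ?leq_addr //.
congr (_ + _); rewrite -[X in \big[_/_]_(X <= _ < _) _]add0n big_addn addKn big_mkord.
by apply: eq_bigr => i _; rewrite [(m * p)%N]mulnC.
Qed.

Lemma sum_coprime_mul (V : nmodType) (p m : nat) (F : nat -> V) : prime p ->
  \sum_(r < p * m | coprime (p * m) r) F r =
  \sum_(i < m | coprime m i) \sum_(t < p | ~~ (p %| i + m * t)%N) F (i + m * t)%N.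
Proof.
move=> pp; rewrite big_mkcond (sum_ord_mul p m (fun r => if coprime (p * m) r then F r else 0)).
rewrite [RHS]big_mkcond; apply: eq_bigr => i _.
have cop (t : 'I_p) : coprime (p * m) (i + m * t) = ~~ (p %| i + m * t)%N && coprime m i.
  rewrite coprimeMl prime_coprime //; congr (_ && _).
  by rewrite /coprime addnC mulnC gcdnMDl.
under eq_bigr => t _ do rewrite cop.
case: (coprime m i); last by rewrite big1 // => t _; rewrite andbF.
by rewrite [RHS]big_mkcond; apply: eq_bigr => t _; rewrite andbT.
Qed.

Lemma dvdn_progression (p m r : nat) : prime p -> ~~ (p %| m)%N ->
  exists t0 : 'I_p, forall t : 'I_p, (p %| r + m * t)%N = (t == t0).
Proof.
move=> pp pm; have p0 := prime_gt0 pp.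
pose f (t : 'I_p) := Ordinal (ltn_pmod (r + m * t) p0).
have f_inj : injective f.
  suff inj (t u : 'I_p) : (t <= u)%N -> f t = f u -> t = u.
    by move=> t u tu; have [/inj h|/ltnW/inj h] := leqP t u; [apply: h | apply/esym/h].
  move=> tu [] /eqP; rewrite eqn_modDl eq_sym eqn_mod_dvd ?leq_mul2l ?tu ?orbT //.
  rewrite -mulnBr Euclid_dvdM // (negbTE pm) /= => dv; apply: val_inj.
  apply/eqP; rewrite eqn_leq tu -subn_eq0 /=; apply: contraLR dv => nz.
  by rewrite gtnNdvd ?lt0n // (leq_ltn_trans (leq_subr _ _)).
exists (invF f_inj (Ordinal p0)) => t; rewrite -(inj_eq f_inj) f_invF.
by rewrite -val_eqE /=.
Qed.

Section MeanSquare.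
Variable C : numClosedFieldType.
Implicit Types (P : {poly int}).

Notation "P ^z" := (map_poly (intr : int -> C) P) (at level 1, format "P ^z").

Definition sum_conj_sq (N : nat) (w : C) P : C :=
  \sum_(r < N | coprime N r) `|P^z.[w ^+ r]| ^+ 2.

Definition num_conj (N : nat) : nat := (\sum_(r < N | coprime N r) 1)%N.

Lemma num_conj_gt0 N : (0 < N)%N -> (0 < num_conj N)%N.
Proof.
case: N => [|[|N]] // _; rewrite /num_conj.
  by rewrite (bigD1 ord0).
by rewrite (bigD1 (Ordinal (isT : 1 < N.+2)%N)) // coprimen1.
Qed.

Lemma poly_int_decomp (p s N : nat) (w : C) P :
  prime p -> coprime s p -> (p %| N)%N -> N.-primitive_root w ->
  exists A : 'I_p -> {poly int}, forall r,
    P^z.[w ^+ r] = \sum_(l < p) (w ^+ (s * r)) ^+ l * (A l)^z.[w ^+ (p * r)].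
Proof.
move=> pp cop pN pw; have p0 := prime_gt0 pp; have N0 := prim_order_gt0 pw.
have wN := prim_expr_order pw.
pose D P := exists A : 'I_p -> {poly int}, forall r,
  P^z.[w ^+ r] = \sum_(l < p) (w ^+ (s * r)) ^+ l * (A l)^z.[w ^+ (p * r)].
rewrite -/(D P) -[P]coefK poly_def; apply: (big_ind D).
- exists (fun=> 0) => r; rewrite rmorph0 horner0 big1 // => l _.
  by rewrite ?map_poly0 ?horner0 mulr0.
- move=> P1 P2 [A1 h1] [A2 h2]; exists (fun l => A1 l + A2 l) => r.
  rewrite rmorphD hornerD h1 h2 -big_split; apply: eq_bigr => l _ /=.
  by rewrite rmorphD hornerD mulrDr.
move=> [e _] _ /=; move: (P`_e) => c.
have [s' ss'] : exists s', (s * s' = 1 %[mod p])%N.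
  have := @chinese_modl s p cop 0 1; rewrite mod0n => /eqP/dvdnP[q sq].
  by exists q; rewrite mulnC -sq; apply: chinese_modr.
pose u := Ordinal (ltn_pmod (e * s') p0).
have [v hv] : exists v, (e + N * (s * u) = s * u + p * v)%N.
  exists ((e + N * (s * u) - s * u) %/ p)%N.
  have le : (s * u <= e + N * (s * u))%N by rewrite (leq_trans _ (leq_addl _ _)) // leq_pmull.
  rewrite [(p * _)%N]mulnC divnK ?subnKC // -eqn_mod_dvd //.
  rewrite -modnDmr -modnMml (eqP (pN : N %% p == 0)%N) mul0n mod0n addn0 /u /=.
  by rewrite modnMmr mulnCA -modnMmr ss' modnMmr muln1.
exists (fun l => if l == u then c *: 'X^v else 0) => r.
rewrite (bigD1 u) //= eqxx [X in _ + X]big1 ?addr0; last first.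
  by move=> l /negbTE->; rewrite map_poly0 horner0 mulr0.
rewrite !map_polyZ !map_polyXn !hornerZ !hornerXn mulrCA; congr (_ * _).
rewrite -!exprM -exprD.
have -> : (s * r * u + p * r * v = r * (s * u + p * v))%N by ring.
by rewrite -hv mulnDr exprD mulnCA [w ^+ (N * _)]exprM wN expr1n mulr1.
Qed.

Lemma decomp_parseval (p m s r : nat) (w : C) (a : 'I_p -> C) :
  prime p -> coprime s p -> (p * m).-primitive_root w ->
  \sum_(t < p) `|\sum_(l < p) (w ^+ (s * (r + m * t))) ^+ l * a l| ^+ 2 =
  p%:R * \sum_(l < p) `|a l| ^+ 2.
Proof.
move=> pp cop pw.
have pz : p.-primitive_root (w ^+ (s * m)).
  have m0 : (0 < m)%N by have := prim_order_gt0 pw; rewrite muln_gt0 => /andP[].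
  have : p.-primitive_root (w ^+ m).
    have := @exp_prim_root _ _ _ pw m.
    by rewrite gcdnMl mulnK.
  by rewrite mulnC exprM => pz; rewrite prim_root_exp_coprime.
have w1 := root1_norm (root1_prim pw).
rewrite -[RHS](_ : p%:R * \sum_(l < p) `|(w ^+ (s * r)) ^+ l * a l| ^+ 2 = _).
  rewrite -(parseval _ pz); apply: eq_bigr => t _; congr (`|_| ^+ 2).
  apply: eq_bigr => l _; rewrite mulrA -!exprM -exprD; congr (_ ^+ _ * _).
  ring.
by congr (_ * _); apply: eq_bigr => l _; rewrite normrM !normrX w1 !expr1n mul1r.
Qed.

Lemma prim_root_exp_mul (p m : nat) (w : C) :
  (p * m).-primitive_root w -> m.-primitive_root (w ^+ p).
Proof.
move=> pw; have := @exp_prim_root _ _ _ pw p.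
rewrite gcdnMr mulKn //.
by have := prim_order_gt0 pw; rewrite muln_gt0 => /andP[].
Qed.

(* [h] is the lower bound being proved, as a function of the length; only the *)
(* primes below [Y] are allowed to cost a factor (of 2).                      *)
Record length_bound (h : nat -> C) (Y : nat) : Prop := LengthBound {
  length_bound_ge0 : forall n, 0 <= h n;
  length_bound_mono : forall n m, (n <= m)%N -> h n <= h m;
  length_bound_subadd : forall n m, h (n + m)%N <= h n + h m;
  length_bound0 : h 0%N = 0;
  length_bound_le : forall n, h n <= n%:R;
  length_bound_metric : forall p, prime p -> (Y <= p)%N -> metric_bound h p }.

Lemma length_bound_sum (h : nat -> C) (Y : nat) (I : finType) (d : I -> nat) :
  length_bound h Y -> h (\sum_i d i)%N <= \sum_i h (d i).
Proof.
move=> hY; elim/big_rec2: _ => [|i y1 y2 _ ih]; first by rewrite (length_bound0 hY).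
by apply: le_trans (length_bound_subadd hY _ _) _; rewrite lerD2l.
Qed.

Definition small_primes (Y N : nat) : nat := (\sum_(q < Y | prime q && (q %| N)) 1)%N.

Lemma small_primes_le Y N : (small_primes Y N <= Y)%N.
Proof. by rewrite /small_primes sum1_card (leq_trans (max_card _)) ?card_ord. Qed.

Lemma small_primes_mono Y m N : (m %| N)%N -> (small_primes Y m <= small_primes Y N)%N.
Proof.
move=> mN; rewrite /small_primes [leqLHS]big_mkcond [leqRHS]big_mkcond.
apply: leq_sum => q _; case: (prime q) => //=.
by have [qm|//] := boolP (q %| m)%N; rewrite (dvdn_trans qm mN).
Qed.

Lemma small_primesM Y p m : prime p -> ~~ (p %| m)%N -> (p < Y)%N ->
  (small_primes Y m < small_primes Y (p * m))%N.
Proof.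
move=> pp pm pY; rewrite /small_primes [ltnLHS]big_mkcond [ltnRHS]big_mkcond.
rewrite (bigD1 (Ordinal pY)) //= [ltnRHS](bigD1 (Ordinal pY)) //=.
rewrite pp (negbTE pm) dvdn_mulr //= add0n ltnS; apply: leq_sum => q _.
case: (prime q) => //=.
by have [qm|//] := boolP (q %| m)%N; rewrite (dvdn_mull _ qm).
Qed.

Lemma half_pow_small_primes Y m N : (m %| N)%N ->
  2^-1 ^+ small_primes Y N <= 2^-1 ^+ small_primes Y m :> C.
Proof.
move=> mN; apply: ler_wiXn2l; rewrite ?invr_ge0 ?invf_le1 ?ler1n ?ltr0n ?ler0n //.
exact: small_primes_mono.
Qed.

Lemma sum_conj_sq_ge (h : nat -> C) Y N (w : C) P :
  length_bound h Y -> N.-primitive_root w ->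
  2^-1 ^+ small_primes Y N * (num_conj N)%:R * h (root1_length P^z.[w]) <=
  sum_conj_sq N w P.
Proof.
move=> hY; have h_sum I d := @length_bound_sum h Y I d hY.
case: hY => h_ge0 h_mono h_subadd h_0 h_le h_metric.
elim/ltn_ind: N w P => N IH w P pw; have N0 := prim_order_gt0 pw.
have [N1|N_neq1] := eqVneq N 1%N.
  move: pw; rewrite N1 => /prim_expr_order; rewrite expr1 => ->.
  rewrite /sum_conj_sq /num_conj !(big_pred1 ord0) ?expr0; last 2 first.
  - by move=> i; rewrite coprime1n /=; apply/esym/eqP; rewrite ord1.
  - by move=> i; rewrite coprime1n /=; apply/esym/eqP; rewrite ord1.
  have [c ->] : exists c : int, P^z.[1] = c%:~R.
    by exists P.[1]; rewrite -(rmorph1 (intr : int -> C)) horner_map.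
  have [_ hc] := root1_lengthP (root1_sum_int C c).
  rewrite mulr1 -intr_norm -abszE.
  apply: (@le_trans _ _ (h `|c|%N)).
    rewrite -[leRHS]mul1r ler_pM ?exprn_ge0 ?invr_ge0 ?ler0n // ?h_mono //.
    by rewrite exprn_ile1 ?invr_ge0 ?ler0n // invf_le1 ?ltr0n // ler1n.
  apply: le_trans (h_le _) _.
  rewrite -pmulrn -natrX ler_nat; case: (`|c|)%N => // n.
  by rewrite expnS leq_pmulr // expn_gt0.
have [p pp /dvdnP[m]] : exists2 p, prime p & (p %| N)%N.
  by exists (pdiv N); [rewrite pdiv_prime // ltn_neqAle eq_sym N_neq1 | exact: pdiv_dvd].
rewrite mulnC => NE; rewrite {}NE in IH pw N0 *; clear N N_neq1.
have p0 := prime_gt0 pp; have p1 := prime_gt1 pp.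
have m0 : (0 < m)%N by move: N0; rewrite muln_gt0 => /andP[].
have IHm Q := IH m (ltn_Pmull p1 m0) (w ^+ p) Q (prim_root_exp_mul pw).
have root1w k : root1 (w ^+ k) by apply/root1X/(root1_prim pw).
have wpr r t : w ^+ (p * (r + m * t)) = (w ^+ p) ^+ r.
  by rewrite mulnDr mulnA exprD exprM [w ^+ (p * m * t)]exprM (prim_expr_order pw) expr1n mulr1.
have genA (A : 'I_p -> {poly int}) i : root1_gen (A i)^z.[w ^+ p].
  exact: root1_gen_horner.
rewrite /sum_conj_sq (sum_coprime_mul m (fun r => `|P^z.[w ^+ r]| ^+ 2)) //.
have numE : num_conj (p * m) = (\sum_(i < m | coprime m i)
    \sum_(t < p | ~~ (p %| i + m * t)) 1)%N by exact: (@sum_coprime_mul nat p m (fun=> 1%N)).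
have [pm|pm] := boolP (p %| m)%N.
  have ndvd (r t : nat) : coprime m r -> ~~ (p %| r + m * t)%N.
    move=> cop; rewrite dvdn_addl ?dvdn_mulr //; apply/negP => pr.
    have : (p %| gcdn m r)%N by rewrite dvdn_gcd pm pr.
    by rewrite (eqP (cop : gcdn m r == 1)%N) dvdn1 => /eqP p1'; rewrite p1' in p1.
  have [A hA] := poly_int_decomp P pp (coprime1n p) (dvdn_mulr m (dvdnn p)) pw.
  have -> : \sum_(i < m | coprime m i) \sum_(t < p | ~~ (p %| i + m * t)%N)
        `|P^z.[w ^+ (i + m * t)]| ^+ 2 =
      p%:R * \sum_(l < p) sum_conj_sq m (w ^+ p) (A l).
    rewrite exchange_big /= mulr_sumr; apply: eq_bigr => i cop.
    rewrite -(decomp_parseval i _ pp (coprime1n p) pw).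
    apply: eq_big => [t|t _]; first exact: ndvd.
    by rewrite hA; under eq_bigr => l _ do rewrite wpr.
  have -> : num_conj (p * m) = (num_conj m * p)%N.
    rewrite numE big_distrl /=; apply: eq_bigr => i cop.
    by rewrite (eq_bigl xpredT) ?sum1_card ?card_ord ?mul1n // => t; exact: ndvd.
  apply: (@le_trans _ _ (p%:R * \sum_(l < p) 2^-1 ^+ small_primes Y m *
      (num_conj m)%:R * h (root1_length (A l)^z.[w ^+ p]))); last first.
    by rewrite ler_wpM2l ?ler0n //; apply: ler_sum => l _.
  rewrite -mulr_sumr mulrA natrM [p%:R * _]mulrC -[_ * p%:R * _]mulrA mulrACA.
  rewrite -!mulrA ler_pM ?exprn_ge0 ?invr_ge0 ?mulr_ge0 ?ler0n //.
    exact/half_pow_small_primes/dvdn_mull.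
  rewrite !mulrA [p%:R * _]mulrC ler_wpM2l ?mulr_ge0 ?ler0n //.
  apply: le_trans (h_sum _ _); apply: h_mono.
  rewrite -[w in leqLHS]expr1 hA !muln1.
  by apply: (@root1_length_sum _ _ (fun l => (A l)^z.[w ^+ p])
               (fun l : 'I_p => (w ^+ 1) ^+ l)) => l //; exact: root1X.
have cop : coprime m p by rewrite coprime_sym prime_coprime.
have [A hA] := poly_int_decomp P pp cop (dvdn_mulr m (dvdnn p)) pw.
pose d i j := root1_length (A i - A j)^z.[w ^+ p].
have CB i j x : (A i - A j)^z.[x] = (A i)^z.[x] - (A j)^z.[x].
  by rewrite rmorphB hornerD hornerN.
have gen_d i j : root1_gen (A i - A j)^z.[w ^+ p] by exact: root1_gen_horner.
have dC i j : d i j = d j i.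
  by rewrite /d -opprB rmorphN hornerN root1_lengthN //; exact: gen_d.
have d_tri i j k : (d i k <= d i j + d j k)%N.
  by rewrite /d (_ : A i - A k = (A i - A j) + (A j - A k));
    [rewrite rmorphD hornerD; apply: root1_lengthD; exact: gen_d | ring].
set n := root1_length _.
have n_le j : (n <= \sum_i d i j)%N.
  have : P^z.[w] = \sum_(l < p) (w ^+ m) ^+ l * (A l - A j)^z.[w ^+ p].
    rewrite -[w in LHS]expr1 hA !muln1.
    under [RHS]eq_bigr => l _ do rewrite CB mulrBr.
    rewrite sumrB -[X in _ - X]mulr_suml sum_expr_root1 ?mul0r ?subr0 //.
      by rewrite -exprM mulnC (prim_expr_order pw).
    rewrite -(prim_order_dvd pw); apply/negP => /(dvdn_leq m0).
    by rewrite leqNgt ltn_Pmull.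
  rewrite /n => ->.
  by apply: (@root1_length_sum _ _ (fun l => (A l - A j)^z.[w ^+ p])
               (fun l : 'I_p => (w ^+ m) ^+ l)) => // l; exact: root1X.
have -> : \sum_(i < m | coprime m i) \sum_(t < p | ~~ (p %| i + m * t)%N)
      `|P^z.[w ^+ (i + m * t)]| ^+ 2 =
    2^-1 * \sum_(j < p) \sum_(i < p) sum_conj_sq m (w ^+ p) (A i - A j).
  have -> : \sum_(j < p) \sum_(i < p) sum_conj_sq m (w ^+ p) (A i - A j) =
      \sum_(r < m | coprime m r) \sum_(i < p) \sum_(j < p)
        `|(A i)^z.[(w ^+ p) ^+ r] - (A j)^z.[(w ^+ p) ^+ r]| ^+ 2.
    rewrite exchange_big [RHS]exchange_big /=; apply: eq_bigr => i _.
    rewrite [RHS]exchange_big /=; apply: eq_bigr => j _.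
    by apply: eq_bigr => r _; rewrite CB.
  rewrite mulr_sumr; apply: eq_bigr => r copr.
  rewrite variance mulKf ?pnatr_eq0 //.
  have [t0 ht0] := dvdn_progression r pp pm.
  have := decomp_parseval r (fun l => (A l)^z.[(w ^+ p) ^+ r]) pp cop pw.
  rewrite (bigD1 t0) //= => /(canRL (addKr _)) E.
  rewrite [X in _ - X](_ : _ = `|\sum_(l < p) w ^+ (m * (r + m * t0)) ^+ l *
     (A l)^z.[(w ^+ p) ^+ r]| ^+ 2); last first.
    congr (`|_| ^+ 2); apply: eq_bigr => l _.
    have /dvdnP[q ->] : (p %| r + m * t0)%N by rewrite ht0.
    by rewrite mulnCA mulnC exprM [(m * p)%N]mulnC (prim_expr_order pw) !expr1n mul1r.
  rewrite addrC -E; apply: eq_big => [t|t _]; first by rewrite ht0.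
  by rewrite hA; congr (`|_| ^+ 2); apply: eq_bigr => l _; rewrite wpr.
have -> : num_conj (p * m) = (num_conj m * p.-1)%N.
  rewrite numE big_distrl /=; apply: eq_bigr => i copi.
  have [t0 ht0] := dvdn_progression i pp pm.
  rewrite (eq_bigl (fun t => t \in predC1 t0)) => [|t]; last by rewrite ht0 inE.
  by rewrite sum1_card cardC1 card_ord mul1n.
apply: (@le_trans _ _ (2^-1 * \sum_(j < p) \sum_(i < p) 2^-1 ^+ small_primes Y m *
    (num_conj m)%:R * h (d i j))); last first.
  rewrite ler_wpM2l ?invr_ge0 ?ler0n //; apply: ler_sum => j _.
  by apply: ler_sum => i _; exact: IHm.
under eq_bigr do rewrite -mulr_sumr.
rewrite -mulr_sumr; set S := \sum_j \sum_i h (d i j).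
have S0 : 0 <= S by apply: sumr_ge0 => j _; apply: sumr_ge0 => i _.
have p1E : p.-1%:R = p%:R - 1 :> C by rewrite -subn1 natrB.
have [pY|Yp] := ltnP p Y.
  rewrite !mulrA -exprS natrM -2!mulrA -[leRHS]mulrA.
  rewrite ler_pM ?exprn_ge0 ?invr_ge0 ?mulr_ge0 ?ler0n //.
    apply: ler_wiXn2l; rewrite ?invr_ge0 ?invf_le1 ?ler1n ?ltr0n ?ler0n //.
    exact: small_primesM.
  rewrite ler_wpM2l ?ler0n //.
  apply: (@le_trans _ _ (p%:R * h n)); first by rewrite ler_wpM2r ?ler_nat ?leq_pred.
  rewrite mulr_natl -[p in _ *+ p]card_ord -sumr_const; apply: ler_sum => j _.
  exact: le_trans (h_mono _ _ (n_le j)) (h_sum _ _).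
rewrite mulrCA -mulrA natrM -!mulrA.
rewrite ler_pM ?exprn_ge0 ?invr_ge0 ?mulr_ge0 ?ler0n //.
  exact/half_pow_small_primes/dvdn_mull.
rewrite ler_wpM2l ?ler0n // -[leLHS](mulKf (x := 2)) ?pnatr_eq0 //.
by rewrite ler_wpM2l ?invr_ge0 ?ler0n // mulrA p1E; apply: h_metric.
Qed.
End MeanSquare.

(** * Conjugates of radicals over cyclotomic fields *)

Section Conjugates.
Variable C : numClosedFieldType.
Implicit Types (P : {poly int}) (Q q : {poly rat}) (w x : C).

Notation "P ^z" := (map_poly (intr : int -> C) P) (at level 1, format "P ^z").
Notation "Q ^q" := (map_poly (ratr : rat -> C) Q) (at level 1, format "Q ^q").

Lemma map_poly_int_rat (F : numFieldType) P :
  map_poly (ratr : rat -> F) (map_poly intr P) = map_poly intr P.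
Proof. by rewrite -map_poly_comp; apply: eq_map_poly => c; rewrite /= ratr_int. Qed.

Lemma prim_root_exists n : (0 < n)%N -> exists z : C, n.-primitive_root z.
Proof.
pose p : {poly C} := 'X^n - 1; have [r Dp] := closed_field_poly_normal p.
move=> n_gt0; rewrite (monicP _) ?monicXnsubC // scale1r in Dp.
have rn1: all n.-unity_root r by apply/allP=> z; rewrite -root_prod_XsubC -Dp.
have sz_r: (n < (size r).+1)%N.
  by rewrite -(size_prod_XsubC r id) -Dp size_XnsubC.
have [|z] := hasP (has_prim_root n_gt0 rn1 _ sz_r); last by exists z.
by rewrite -separable_prod_XsubC -Dp separable_Xn_sub_1 // pnatr_eq0 -lt0n.
Qed.

Lemma root_Cyclotomic n w : n.-primitive_root w -> root ('Phi_n)^z w.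
Proof.
move=> pw; have n0 := prim_order_gt0 pw.
have : root (\prod_(d <- divisors n) 'Phi_d)^z w.
  by rewrite prod_Cyclotomic // rmorphB rmorph1 /= map_polyXn rootE !hornerE
     (prim_expr_order pw) subrr.
rewrite rmorph_prod rootE horner_prod prodf_seq_eq0 => /hasP[d dn] /= rd.
move: dn; rewrite -dvdn_divisors // => dn; have d0 := dvdn_gt0 n0 dn.
suff : w ^+ d = 1.
  move/eqP; rewrite -(prim_order_dvd pw) => nd.
  by have /eqP <- : d == n by rewrite eqn_dvd dn.
have /eqP : ('X^d - 1 : {poly int})^z.[w] == 0.
  rewrite -prod_Cyclotomic // rmorph_prod horner_prod prodf_seq_eq0.
  by apply/hasP; exists d => //; rewrite -dvdn_divisors.
rewrite rmorphB rmorph1 /= map_polyXn !hornerE => /eqP.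
by rewrite subr_eq0 => /eqP.
Qed.

Lemma Cyclotomic_dvdp n w q : n.-primitive_root w -> root q^q w ->
  map_poly intr 'Phi_n %| q.
Proof.
move=> pw qw; have n0 := prim_order_gt0 pw.
pose F : {poly rat} := map_poly intr 'Phi_n.
have Fw : root F^q w by rewrite map_poly_int_rat root_Cyclotomic.
have Fn0 : F != 0.
  by rewrite map_poly_eq0_id0 ?intr_eq0 ?lead_coef_eq0 ?monic_neq0 ?Cyclotomic_monic.
pose g := gcdp F q; have gw : root g^q w by rewrite gcdp_map root_gcd Fw.
have gn0 : g != 0 by rewrite gcdp_eq0 negb_and Fn0.
have size_g : (1 < size g)%N.
  by rewrite -(size_map_poly (ratr : rat -> C)); apply: root_size_gt1 gw; rewrite map_poly_eq0.
have [z] : exists z : algC, root (map_poly ratr g) z.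
  by apply/closed_rootP; rewrite size_map_poly neq_ltn size_g orbT.
move=> gz; have [z0 pz0] := C_prim_root_exists n0.
have pz : n.-primitive_root z.
  rewrite -(root_cyclotomic pz0) -(Cintr_Cyclotomic pz0) -(map_poly_int_rat algC).
  by apply: (root_dvdp _ gz); rewrite dvdp_map dvdp_gcdl.
have [m [Dm _] min_m] := minCpolyP z.
have : map_poly (ratr : rat -> algC) m = map_poly ratr F.
  by rewrite -Dm (minCpoly_cyclotomic pz) -(Cintr_Cyclotomic pz) map_poly_int_rat.
move/(map_inj_poly (fmorph_inj _) (rmorph0 _)) => mF; rewrite -/F -mF.
by apply: dvdp_trans (dvdp_gcdr F q); rewrite -min_m.
Qed.

Lemma root_conj_cyclotomic n w q r : n.-primitive_root w -> coprime n r ->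
  root q^q w -> root q^q (w ^+ r).
Proof.
move=> pw co qw; apply: (@root_dvdp _ (map_poly intr 'Phi_n)^q).
  by rewrite dvdp_map (Cyclotomic_dvdp pw).
by rewrite map_poly_int_rat root_Cyclotomic // prim_root_exp_coprime // coprime_sym.
Qed.

Lemma horner_conj_cyclotomic n w q q' r : n.-primitive_root w -> coprime n r ->
  q^q.[w] = q'^q.[w] -> q^q.[w ^+ r] = q'^q.[w ^+ r].
Proof.
move=> pw co E; have := @root_conj_cyclotomic n w (q - q') r pw co.
rewrite !rootE rmorphB !hornerE E subrr eqxx => /(_ isT).
by rewrite subr_eq0 => /eqP.
Qed.

Lemma conj_horner_ratp Q x : (Q^q.[x])^* = Q^q.[x^*].
Proof.
rewrite -(horner_map Num.conj) -map_poly_comp.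
by congr _.[_]; apply: eq_map_poly => c; rewrite /= fmorph_rat.
Qed.

(* A positive real radical in an abelian field has only real conjugates, *)
(* all of the same absolute value, so its square is rational.            *)
Lemma real_radical_cyclotomic n w Q M A : n.-primitive_root w -> (0 < M)%N ->
  0 < Q^q.[w] -> Q^q.[w] ^+ M = A%:R -> exists rho : rat, Q^q.[w] ^+ 2 = ratr rho.
Proof.
move=> pw M0 th0 thM; have n0 := prim_order_gt0 pw; set th := Q^q.[w] in th0 thM *.
have w1 := root1_norm (root1_prim pw).
have conj_pow r : (w ^+ r)^* = (w ^+ r) ^+ n.-1.
  rewrite rmorphXn /=; have -> : w^* = w^-1 by rewrite invC_norm w1 expr1n invr1 mul1r.
  have -> : w^-1 = w ^+ n.-1.
    have w0 : w != 0 by rewrite -normr_eq0 w1 oner_eq0.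
    by apply: (mulfI w0); rewrite divff // -exprS prednK // prim_expr_order.
  by rewrite -!exprM mulnC.
have sq_conj r : coprime n r -> Q^q.[w ^+ r] ^+ 2 = th ^+ 2.
  move=> co; have compE x : (Q \Po 'X^(n.-1))^q.[x] = Q^q.[x ^+ n.-1].
    by rewrite map_comp_poly map_polyXn horner_comp hornerXn.
  have real_r : (Q^q.[w ^+ r])^* = Q^q.[w ^+ r].
    rewrite conj_horner_ratp conj_pow -compE; apply/esym.
    apply: (horner_conj_cyclotomic pw co).
    rewrite compE -[w in w ^+ n.-1]expr1 -conj_pow expr1 -conj_horner_ratp.
    by apply/esym/CrealP/ger0_real/ltW.
  have : (Q ^+ M)^q.[w ^+ r] = (A%:R%:P)^q.[w ^+ r].
    apply: (horner_conj_cyclotomic pw co).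
    by rewrite rmorphXn /= horner_exp map_polyC hornerC /= ratr_nat.
  rewrite rmorphXn /= horner_exp map_polyC hornerC /= ratr_nat -thM.
  move=> /(congr1 (fun x => `|x|)); rewrite !normrX => /eqP.
  rewrite eqrXn2 ?normr_ge0 // => /eqP E.
  have r_real : Q^q.[w ^+ r] \is Num.real by apply/CrealP.
  by rewrite -(real_normK r_real) E real_normK // ger0_real // ltW.
pose F : {poly rat} := map_poly intr 'Phi_n.
have F_monic : F \is monic by rewrite monic_map // Cyclotomic_monic.
pose S := (Q ^+ 2) %% F; exists S`_0.
have SE r : coprime n r -> S^q.[w ^+ r] = th ^+ 2.
  move=> co; rewrite -(sq_conj _ co) -horner_exp -rmorphXn /= [in RHS](divp_eq (Q ^+ 2) F).
  rewrite rmorphD rmorphM /= !hornerE [F^q.[_]](_ : _ = 0) ?mulr0 ?add0r //.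
  apply/eqP; rewrite -rootE map_poly_int_rat root_Cyclotomic //.
  by rewrite prim_root_exp_coprime // coprime_sym.
have sizeF : size F = (totient n).+1.
  by rewrite size_map_poly_id0 ?size_Cyclotomic // (monicP (Cyclotomic_monic n)) oner_eq0.
have sizeS : (size (S^q - (th ^+ 2)%:P)%R <= totient n)%N.
  rewrite (leq_trans (size_polyD _ _)) // geq_max size_map_poly -ltnS -sizeF.
  rewrite ltn_modp monic_neq0 //= size_polyN (leq_trans (size_polyC_leq1 _)) //.
  by rewrite totient_gt0.
have [/eqP|nz] := eqVneq (S^q - (th ^+ 2)%:P) 0.
  rewrite subr_eq0 => /eqP /(congr1 (fun p : {poly C} => p`_0)).
  by rewrite coef_map coefC /= => ->.
pose rs := [seq w ^+ r | r <- iota 0 n & coprime n r].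
have : (size rs < size (S^q - (th ^+ 2)%:P)%R)%N.
  apply: max_poly_roots => //.
    apply/allP => y /mapP[r]; rewrite mem_filter => /andP[co _] ->.
    by rewrite rootE !hornerE SE // subrr.
  rewrite map_inj_in_uniq ?filter_uniq ?iota_uniq // => i j.
  rewrite !mem_filter !mem_iota add0n => /andP[_ /= i_n] /andP[_ /= j_n] /eqP.
  by rewrite (eq_prim_root_expr pw) !modn_small // => /eqP.
rewrite size_map size_filter -sum1_count big_mkcond.
move=> /leq_trans/(_ sizeS); rewrite totient_count_coprime /index_iota subn0.
by rewrite (eq_bigr (fun r => coprime n r : nat)) ?ltnn // => i _; case: coprime.
Qed.

End Conjugates.

Section Kummer.
Variable C : numClosedFieldType.
Implicit Types (P : {poly int}) (Q q : {poly rat}) (w x : C).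

Notation "P ^z" := (map_poly (intr : int -> C) P) (at level 1, format "P ^z").
Notation "Q ^q" := (map_poly (ratr : rat -> C) Q) (at level 1, format "Q ^q").

Lemma kummer_indep (K : fieldType) (iota : {rmorphism K -> C}) (al : C) d (z b : K) :
  (0 < d)%N -> d.-primitive_root (iota z) -> 0 < al -> al ^+ d = iota b ->
  (forall e k, (0 < e < d)%N -> al ^+ e != iota k) ->
  forall f : {poly K}, (size f <= d)%N -> root (map_poly iota f) al -> f = 0.
Proof.
move=> d0 pz al0 ald al_e f sz_f fal; apply/eqP; apply: contraT => fn0.
have z1 := root1_norm (root1_prim pz).
have XdE : 'X^d - (iota b)%:P = \prod_(i < d) ('X - (iota z ^+ i * al)%:P).
  have : \prod_(i < d) ('X - (iota z ^+ i)%:P) \Po (al^-1 *: 'X) = 'X^d - 1 \Po (al^-1 *: 'X).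
    by rewrite -(factor_Xn_sub_1 pz) big_mkord.
  rewrite rmorph_prod /= comp_polyB comp_Xn_poly comp_polyC => /(congr1 ( *:%R (al ^+ d))).
  rewrite exprZn scalerBr scalerA -exprMn divff ?gt_eqF // expr1n scale1r alg_polyC ald => <-.
  rewrite -ald -[in LHS](_ : \prod_(i < d) al = al ^+ d); last by rewrite prodr_const card_ord.
  rewrite -scaler_prod; apply: eq_bigr => i _.
  rewrite comp_polyB comp_polyX comp_polyC scalerBr scalerA divff ?gt_eqF // scale1r.
  by rewrite -mul_polyC -polyCM mulrC.
pose g := gcdp f ('X^d - b%:P).
have Xd_map : map_poly iota ('X^d - b%:P) = 'X^d - (iota b)%:P.
  by rewrite rmorphB /= map_polyXn map_polyC.
have g_al : root (map_poly iota g) al.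
  by rewrite gcdp_map root_gcd fal Xd_map rootE !hornerE ald subrr.
have gn0 : g != 0 by rewrite gcdp_eq0 negb_and fn0.
have [m /eqpP[[c1 c2] /= /andP[c1n0 c2n0] Dg]] :
    {m | map_poly iota g %= \prod_(i <- mask m (index_enum 'I_d)) ('X - (iota z ^+ i * al)%:P)}.
  by apply: dvdp_prod_XsubC; rewrite -XdE -Xd_map dvdp_map dvdp_gcdr.
set s := mask m _ in Dg; pose e := size s.
have size_g : size g = e.+1.
  rewrite -(size_map_poly iota) -(size_scale _ c1n0) Dg size_scale //.
  by rewrite size_prod_XsubC.
have e0 : (0 < e)%N.
  rewrite -ltnS -size_g -(size_map_poly iota); apply: root_size_gt1 g_al.
  by rewrite map_poly_eq0.
have ed : (e < d)%N.
  by rewrite -size_g (leq_trans _ sz_f) // dvdp_leq // dvdp_gcdl.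
have lead : c1 * iota (lead_coef g) = c2.
  rewrite -lead_coef_map -lead_coefZ Dg lead_coefZ (monicP _) ?mulr1 //.
  exact: monic_prod_XsubC.
pose t := (\sum_(i <- s) (i : nat))%N.
have cst : c1 * iota g`_0 = c2 * ((-1) ^+ e * (iota z ^+ t * al ^+ e)).
  have := congr1 (fun p : {poly C} => p.[0]) Dg; rewrite /= !hornerZ.
  rewrite horner_coef0 coef_map => ->; congr (_ * _).
  rewrite horner_prod /t /e; elim: (s) => [|i r ih].
    by rewrite !big_nil !expr0 !mul1r.
  rewrite !big_cons ih !hornerE exprD /= !exprS; ring.
pose k := g`_0 / lead_coef g * ((-1) ^+ e * z ^- t).
have : al ^+ e != iota k by apply: al_e; rewrite e0.
case/negP.
have lg0 : iota (lead_coef g) != 0 by rewrite fmorph_eq0 lead_coef_eq0.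
have zt0 : iota z ^+ t != 0 by rewrite expf_neq0 // -normr_eq0 z1 oner_eq0.
have s1 : (-1) ^+ e * (-1) ^+ e = 1 :> C by rewrite -exprMn mulrNN mulr1 expr1n.
apply/eqP; rewrite /k rmorphM rmorphM fmorphV rmorphM fmorphV !rmorphXn rmorphN1 /=.
have -> : iota g`_0 = iota (lead_coef g) * ((-1) ^+ e * (iota z ^+ t * al ^+ e)).
  by apply: (mulfI c1n0); rewrite cst -lead -!mulrA.
move: ((-1) ^+ e : C) (iota z ^+ t) (al ^+ e) (iota _) s1 zt0 lg0 => u v x y s1 v0 y0.
rewrite -[LHS]mul1r -s1; field.
by rewrite y0 v0.
Qed.
End Kummer.

Section RadicalConjugates.
Variable C : numClosedFieldType.
Implicit Types (P : {poly int}) (Q q : {poly rat}) (w x : C).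

Notation "P ^z" := (map_poly (intr : int -> C) P) (at level 1, format "P ^z").
Notation "Q ^q" := (map_poly (ratr : rat -> C) Q) (at level 1, format "Q ^q").

Let evq x : {rmorphism {poly rat} -> C} := horner_eval x \o map_poly ratr.

Lemma root_conj_radical n w al d G (P : 'I_d -> {poly int}) q r al' :
  n.-primitive_root w -> (0 < d)%N -> (d %| n)%N -> 0 < al -> al ^+ d = G^z.[w] ->
  (forall e Q, (0 < e < d)%N -> al ^+ e != Q^q.[w]) ->
  coprime n r -> al' ^+ d = G^z.[w ^+ r] ->
  root q^q (\sum_j (P j)^z.[w] * al ^+ j) ->
  root q^q (\sum_j (P j)^z.[w ^+ r] * al' ^+ j).
Proof.
move=> pw d0 dn al0 ald al_e co ald' qr.
pose toQ (F : {poly int}) : {poly rat} := map_poly intr F.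
have evqE x F : evq x (toQ F) = F^z.[x] by rewrite /= /horner_eval map_poly_int_rat.
pose B : {poly {poly rat}} := \sum_j (toQ (P j))%:P * 'X^j.
have evB x y : (map_poly (evq x) B).[y] = \sum_j (P j)^z.[x] * y ^+ j.
  rewrite rmorph_sum horner_sum; apply: eq_bigr => j _.
  by rewrite rmorphM /= map_polyC map_polyXn !hornerE -evqE.
pose E := map_poly polyC q \Po B.
have evE x y : (map_poly (evq x) E).[y] = q^q.[\sum_j (P j)^z.[x] * y ^+ j].
  rewrite -evB map_comp_poly horner_comp -map_poly_comp; congr _.[_].
  by apply: eq_map_poly => c; rewrite /= /horner_eval map_polyC hornerC.
pose M : {poly {poly rat}} := 'X^d - (toQ G)%:P.
have M_monic : M \is monic by rewrite monicXnsubC.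
have evM x y : (map_poly (evq x) M).[y] = y ^+ d - G^z.[x].
  by rewrite rmorphB /= map_polyXn map_polyC !hornerE -evqE.
pose S := Pdiv.Ring.rmodp E M.
have size_S : (size S <= d)%N.
  by rewrite -ltnS -(size_XnsubC (toQ G) d0) Pdiv.Ring.ltn_rmodpN0 ?monic_neq0.
have evS x y : y ^+ d = G^z.[x] -> (map_poly (evq x) S).[y] = (map_poly (evq x) E).[y].
  move=> yd; rewrite [in RHS](Pdiv.RingMonic.rdivp_eq M_monic E) rmorphD rmorphM /=.
  by rewrite !hornerE evM yd subrr mulr0 add0r.
suff coefS k : evq w S`_k = 0.
  rewrite rootE -evE -evS // horner_coef big1 // => k _.
  rewrite coef_map -[X in X * _](_ : 0 = _) ?mul0r //; apply/esym/eqP.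
  by apply: (root_conj_cyclotomic pw co); rewrite rootE; apply/eqP/coefS.
have Fn0 : map_poly (intr : int -> rat) 'Phi_n != 0.
  by rewrite map_poly_eq0_id0 ?intr_eq0 ?lead_coef_eq0 ?monic_neq0 ?Cyclotomic_monic.
have Fw : root (map_poly (intr : int -> rat) 'Phi_n)^q w.
  by rewrite map_poly_int_rat root_Cyclotomic.
pose K := subFExtend (ratr : rat -> C) w (map_poly intr 'Phi_n).
pose ev : {rmorphism {poly rat} -> K} := @subfx_eval _ _ _ w (map_poly intr 'Phi_n).
pose iota : {rmorphism K -> C} := @subfx_inj _ _ _ w (map_poly intr 'Phi_n).
have iotaE Q : iota (ev Q) = evq w Q by rewrite /= subfx_inj_eval.
suff /polyP/(_ k) : map_poly ev S = 0.
  by rewrite coef_map coef0 -iotaE => ->; rewrite rmorph0.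
apply: (@kummer_indep _ K iota al d (ev ('X^(n %/ d))) (ev (toQ G))) => //.
- rewrite iotaE /= /horner_eval map_polyXn hornerXn.
  by have := dvdn_prim_root pw dn.
- by rewrite iotaE evqE.
- by move=> e k' he; have [Q ->] := subfxE k'; rewrite (iotaE Q); apply: al_e.
- exact: leq_trans (size_poly _ _) size_S.
rewrite -map_poly_comp rootE (eq_map_poly (g := evq w)) => [|Q]; last exact: iotaE.
by rewrite evS // evE.
Qed.

Lemma radical_perfect_power (a N e : nat) (al : C) (rho : rat) :
  (0 < a)%N -> (forall (b : rat) m, (2 <= m)%N -> a%:R <> b ^+ m) -> (0 < N)%N ->
  al ^+ N = a%:R -> al ^+ e = ratr rho -> (N %| e)%N.
Proof.
move=> a0 npp N0 alN ale.
have [c _ /dvdnP[k Hk]] := Bezoutl e N0.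
pose g := gcdn N e; have g0 : (0 < g)%N by rewrite gcdn_gt0 N0.
have al0 : al != 0.
  by apply/eqP => al0; move: alN; rewrite al0 expr0n gtn_eqF // => /eqP;
     rewrite eq_sym pnatr_eq0 gtn_eqF.
have alg : al ^+ g = ratr (a%:R ^+ k / rho ^+ c).
  have : al ^+ (g + c * e) = al ^+ (k * N) by rewrite Hk.
  rewrite exprD (mulnC c) (mulnC k) !exprM alN ale => E.
  rewrite rmorphM fmorphV !rmorphXn /= ratr_nat -E mulfK // expf_neq0 //.
  by rewrite -ale expf_neq0.
have : a%:R = (a%:R ^+ k / rho ^+ c) ^+ (N %/ g).
  apply: (fmorph_inj (ratr : {rmorphism rat -> C})).
  by rewrite rmorphXn /= -alg ratr_nat -exprM mulnC divnK ?dvdn_gcdl.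
have [ge2 h|lt2 _] := leqP 2 (N %/ g); first by case: (npp _ _ ge2 h).
have le1 : (N %/ g <= 1)%N := lt2.
suff -> : N = g by exact: dvdn_gcdr.
rewrite -[LHS](divnK (dvdn_gcdl N e)) -/g; apply/eqP; rewrite -[eqbRHS]mul1n.
by rewrite eqn_pmul2r // eqn_leq le1 divn_gt0 // dvdn_leq // dvdn_gcdl.
Qed.

Lemma prod_1sub_prim_root n (z : C) : n.+1.-primitive_root z ->
  \prod_(j < n) (1 - z ^+ j.+1) = n.+1%:R.
Proof.
move=> pz; have : ('X - 1) * \prod_(j < n) ('X - (z ^+ j.+1)%:P) =
    ('X - 1) * \sum_(i < n.+1) 'X^i.
  rewrite -[RHS]subrX1 -(factor_Xn_sub_1 pz) big_mkord big_ord_recl expr0.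
  by [].
have nz : 'X - 1 != 0 :> {poly C} by rewrite -polyC1 polyXsubC_eq0.
move/(mulfI nz) => /(congr1 (fun p : {poly C} => p.[1])); rewrite horner_prod horner_sum.
under eq_bigr do rewrite hornerXsubC; move=> ->.
by under eq_bigr do rewrite hornerXn expr1n; rewrite sumr_const card_ord.
Qed.
End RadicalConjugates.

Section RadicalDegree.
Variable C : numClosedFieldType.
Implicit Types (P : {poly int}) (Q q : {poly rat}) (w x : C).

Notation "P ^z" := (map_poly (intr : int -> C) P) (at level 1, format "P ^z").
Notation "Q ^q" := (map_poly (ratr : rat -> C) Q) (at level 1, format "Q ^q").

Lemma sqrt_nat_cyclotomic n w a : n.-primitive_root w -> (0 < a)%N ->
  (8 * a %| n)%N -> exists G : {poly int}, G^z.[w] ^+ 2 = a%:R.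
Proof.
move=> pw; have n0 := prim_order_gt0 pw.
have evXn k : ('X^k)^z.[w] = w ^+ k by rewrite map_polyXn hornerXn.
have wn1 k m : (k * m)%N = n -> (1 < k)%N -> w ^+ m != 1.
  move=> km k1; have m0 : (0 < m)%N by move: n0; rewrite -km muln_gt0 => /andP[].
  by rewrite -(prim_order_dvd pw) gtnNdvd // -km ltn_Pmull.
have wN1 m : (2 * m)%N = n -> w ^+ m = -1.
  move=> m2; have /eqP : (w ^+ m) ^+ 2 = 1 by rewrite -exprM mulnC m2 prim_expr_order.
  by rewrite sqrf_eq1 (negbTE (wn1 _ _ m2 isT)) => /eqP.
elim/ltn_ind: a => a IH a0 /dvdnP[c nE].
have [odd_a|even_a] := boolP (odd a); last first.
  pose b := a./2; have aE : a = (2 * b)%N by rewrite mul2n -[LHS]odd_double_half (negbTE even_a).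
  have b0 : (0 < b)%N by move: a0; rewrite aE muln_gt0.
  have [||G HG] := IH b _ b0; first by rewrite aE ltn_Pmull.
    by rewrite nE aE; apply/dvdnP; exists (c * 2)%N; ring.
  pose u := w ^+ (a * c); exists (G * ('X^(a * c) + 'X^(a * c * 7))).
  rewrite rmorphM rmorphD /= !hornerE !evXn [w ^+ (a * c * 7)]exprM -/u.
  have u4 : u ^+ 4 = -1 by rewrite -exprM wN1 // nE; ring.
  have -> : (G^z.[w] * (u + u ^+ 7)) ^+ 2 =
    G^z.[w] ^+ 2 * (u ^+ 2 + 2 * (u ^+ 4) ^+ 2 + u ^+ 2 * (u ^+ 4) ^+ 3) by ring.
  by rewrite u4 HG aE natrM; ring.
pose h := a./2; have aE : a = (h + h).+1 by rewrite addnn -[LHS]odd_double_half odd_a.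
pose z := w ^+ (8 * c); pose v := w ^+ (4 * c); pose i4 := w ^+ (2 * a * c).
have pz : a.-primitive_root z.
  have := dvdn_prim_root pw (_ : a %| n)%N; rewrite nE.
  have -> : (c * (8 * a) %/ a = 8 * c)%N by rewrite mulnA mulnK // mulnC.
  by apply; rewrite mulnA dvdn_mull.
have i4E : i4 ^+ 2 = -1 by rewrite -exprM wN1 // nE; ring.
have vE : v ^+ 2 = z by rewrite -exprM; congr (w ^+ _); ring.
exists (\prod_(j < h) ('X^(2 * a * c) * 'X^(4 * c * (a - j.+1)) * (1 - 'X^(8 * c * j.+1)))).
rewrite rmorph_prod horner_prod -prodrXl.
have -> : a%:R = (h + h).+1%:R :> C by rewrite -aE.
rewrite -(@prod_1sub_prim_root C (h + h) z) -?aE // big_split_ord /=.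
rewrite [X in _ = _ * X](reindex_inj rev_ord_inj) -big_split /=; apply: eq_bigr => j _.
rewrite !rmorphM rmorphB rmorph1 /= !hornerE !evXn -/i4 ![w ^+ (_ * _ * _.+1)]exprM -/z.
rewrite [w ^+ (4 * c * _)]exprM -/v !exprMn i4E -exprM mulnC exprM vE.
have -> : (h + (h - j.+1)).+1 = (a - j.+1)%N.
  by rewrite aE subSS addnBA // -subSn // (leq_trans (ltn_ord j)) ?leq_addr.
have E : z ^+ (a - j.+1) * z ^+ j.+1 = 1.
  rewrite -exprD subnK ?(prim_expr_order pz) // aE ltnS.
  by rewrite (leq_trans _ (leq_addr _ _)) // ltnW.
move: (z ^+ (a - j.+1)) (z ^+ j.+1) E => x y E.
have -> : 1 - x = - (x * (1 - y)) by rewrite mulrBr E; ring.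
by ring.
Qed.

Lemma radical_degree n w a N (al : C) : n.-primitive_root w -> (0 < a)%N ->
  a = 1%N \/ (forall (b : rat) m, (2 <= m)%N -> a%:R <> b ^+ m) ->
  (0 < N)%N -> (8 * a * N %| n)%N -> 0 < al -> al ^+ N = a%:R ->
  exists d A (G : {poly int}),
    [/\ (0 < d <= N)%N /\ (d %| n)%N, al ^+ d = G^z.[w], G^z.[w] ^+ 2 = A%:R, (0 < A)%N &
      forall e Q, (0 < e < d)%N -> al ^+ e != Q^q.[w]].
Proof.
move=> pw a0 a_npp N0 Nn al0 alN.
have cstE (c : nat) : (c%:R%:P : {poly int})^z.[w] = c%:R.
  by rewrite map_polyC hornerC /= rmorph_nat.
have [a1|npp] := a_npp.
  exists 1%N, 1%N, 1%N%:R%:P; rewrite cstE dvd1n N0 expr1n expr1.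
  split=> //; last by case=> [|[]].
  by apply/eqP; rewrite -(@pexpr_eq1 _ _ N) ?ltW // alN a1.
have Ne e Q : (0 < e)%N -> al ^+ e = Q^q.[w] -> (N %| 2 * e)%N.
  move=> e0 E; have al_e : 0 < al ^+ e by rewrite exprn_gt0.
  have [rho Hrho] : exists rho : rat, Q^q.[w] ^+ 2 = ratr rho.
    apply: (@real_radical_cyclotomic C n w Q N (a ^ e)) => //; rewrite -E //.
    by rewrite exprAC alN natrX.
  apply: (radical_perfect_power a0 npp N0 alN (rho := rho)).
  by rewrite mulnC exprM E.
have [odd_N|even_N] := boolP (odd N).
  exists N, (a ^ 2)%N, a%:R%:P; rewrite cstE natrX N0 leqnn expn_gt0 a0.
  split=> //; first by split=> //; apply: dvdn_trans Nn; rewrite dvdn_mull.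
  move=> e Q /andP[e0 eN]; apply/eqP => /(Ne _ _ e0).
  by rewrite Gauss_dvdr ?coprimen2 // gtnNdvd.
pose d := N./2; have NE : N = (2 * d)%N by rewrite mul2n -[LHS]odd_double_half (negbTE even_N).
have d0 : (0 < d)%N by move: N0; rewrite NE muln_gt0.
have [G HG] : exists G : {poly int}, G^z.[w] ^+ 2 = a%:R.
  by apply: sqrt_nat_cyclotomic pw a0 _; apply: dvdn_trans Nn; rewrite dvdn_mulr.
have [G' [HG' ald]] : exists G' : {poly int}, G'^z.[w] ^+ 2 = a%:R /\ al ^+ d = G'^z.[w].
  have : (al ^+ d) ^+ 2 = G^z.[w] ^+ 2 by rewrite HG -exprM mulnC -NE.
  move/eqP; rewrite eqf_sqr => /orP[]/eqP E; first by exists G.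
  by exists (- G); rewrite rmorphN hornerN sqrrN.
exists d, a, G'; split=> //.
  split; first by rewrite d0 NE leq_pmull.
  by apply: dvdn_trans Nn; rewrite NE mulnA dvdn_mull.
move=> e Q /andP[e0 ed]; apply/eqP => /(Ne _ _ e0).
by rewrite NE dvdn_pmul2l // gtnNdvd.
Qed.
End RadicalDegree.

Section MeanSquareRadical.
Variable C : numClosedFieldType.
Implicit Types (P : {poly int}) (Q q : {poly rat}) (w x : C).

Notation "P ^z" := (map_poly (intr : int -> C) P) (at level 1, format "P ^z").
Notation "Q ^q" := (map_poly (ratr : rat -> C) Q) (at level 1, format "Q ^q").

Lemma sum_conj_sq_radical_le n w d A G (P : 'I_d -> {poly int}) (H : C) :
  n.-primitive_root w -> (0 < d)%N -> (d %| n)%N ->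
  G^z.[w] ^+ 2 = A%:R -> (0 < A)%N -> 0 <= H ->
  (forall r x, coprime n r -> x ^+ d = G^z.[w ^+ r] ->
     `|\sum_j (P j)^z.[w ^+ r] * x ^+ j| <= H) ->
  \sum_j sum_conj_sq n w (P j) <= (num_conj n)%:R * H ^+ 2.
Proof.
move=> pw d0 dn GA A0 H0 Hle; rewrite /sum_conj_sq exchange_big /= natr_sum mulr_suml.
apply: ler_sum => r co; rewrite mul1r.
have Gr : G^z.[w ^+ r] ^+ 2 = A%:R.
  have := @horner_conj_cyclotomic C n w (map_poly intr (G ^+ 2)) A%:R%:P r pw co.
  rewrite !map_poly_int_rat !rmorphXn /= !horner_exp !map_polyC !hornerC /= ratr_nat.
  by apply.
pose x := d.-root G^z.[w ^+ r]; have xd : x ^+ d = G^z.[w ^+ r] by rewrite rootCK.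
have x1 : 1 <= `|x|.
  rewrite -(@expr_ge1 _ (d * 2)) ?muln_gt0 ?d0 //.
  by rewrite -normrX exprM xd Gr normr_nat ler1n.
have pz := dvdn_prim_root pw dn; set z := w ^+ _ in pz.
have d_gt0 : 0 < d%:R :> C by rewrite ltr0n.
rewrite -(ler_pM2l d_gt0).
apply: (@le_trans _ _ (d%:R * \sum_j `|(P j)^z.[w ^+ r] * x ^+ j| ^+ 2)).
  rewrite ler_pM2l //; apply: ler_sum => j _; rewrite normrM exprMn.
  by rewrite ler_peMr ?exprn_ge0 // exprn_ege1 // normrX exprn_ege1.
rewrite -(parseval _ pz) mulr_natl -[d in _ *+ d]card_ord -sumr_const.
apply: ler_sum => s _; rewrite lerXn2r ?nnegrE //.
rewrite (eq_bigr (fun j : 'I_d => (P j)^z.[w ^+ r] * (z ^+ s * x) ^+ j)) => [|j _].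
  by apply: Hle => //; rewrite exprMn xd -exprM mulnC exprM (prim_expr_order pz) expr1n mul1r.
by rewrite exprMn mulrCA.
Qed.

Definition radical_sum (al : C) N (x : C) (l : nat) :=
  exists s : seq (C * nat), [/\ size s = l,
    forall u, u \in s -> root1 u.1 /\ (u.2 < N)%N & x = \sum_(u <- s) u.1 * al ^+ u.2].

Lemma common_order (s : seq (C * nat)) : (forall u, u \in s -> root1 u.1) ->
  exists2 n, (0 < n)%N & forall u, u \in s -> u.1 ^+ n = 1.
Proof.
elim: s => [|u s IH] h; first by exists 1%N.
have [m m0 um] := h u (mem_head _ _).
have [|n n0 sn] := IH; first by move=> v vs; apply: h; rewrite inE vs orbT.
exists (m * n)%N => [|v]; first by rewrite muln_gt0 m0.
rewrite inE => /orP[/eqP->|/sn vn]; first by rewrite exprM um expr1n.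
by rewrite mulnC exprM vn expr1n.
Qed.

Lemma radical_sum_bound (h : nat -> C) (Y a N l : nat) (al g H : C) :
  length_bound h Y -> (0 < a)%N -> a = 1%N \/ (forall (b : rat) m, (2 <= m)%N -> a%:R <> b ^+ m) ->
  (0 < N)%N -> 0 < al -> al ^+ N = a%:R -> radical_sum al N g l -> 0 <= H ->
  (forall g', (forall q, root q^q g -> root q^q g') -> `|g'| <= H) ->
  exists2 l', radical_sum al N g l' & 2^-1 ^+ Y * h l' <= H ^+ 2.
Proof.
move=> hY a0 npp N0 al0 alN [s [_ hs gE]] H0 Hle.
have [n1 n1_gt0 sn1] := common_order (fun u us => proj1 (hs u us)).
pose n := (8 * a * N * n1)%N; have n_gt0 : (0 < n)%N by rewrite !muln_gt0 a0 N0.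
have [w pw] := prim_root_exists C n_gt0.
have [d [A [G [[/andP[d0 dN] dn] ald GA A0 al_e]]]] :=
  radical_degree pw a0 npp N0 (dvdn_mulr _ (dvdnn _)) al0 alN.
have [P gP] : exists P : 'I_d -> {poly int}, g = \sum_j (P j)^z.[w] * al ^+ j.
  have hs' u : u \in s -> u.1 ^+ n = 1.
    by move=> /sn1 u1; rewrite /n mulnC exprM u1 expr1n.
  rewrite gE; elim: (s) hs' => [|u s' IH] hs'.
    exists (fun=> 0); rewrite big_nil big1 // => j _; by rewrite rmorph0 horner0 mul0r.
  have [|P' HP'] := IH; first by move=> v vs; apply: hs'; rewrite inE vs orbT.
  have [k Hk] := prim_rootP pw (hs' u (mem_head _ _)).
  pose j0 := Ordinal (ltn_pmod u.2 d0).
  exists (fun j => P' j + (if j == j0 then 'X^k * G ^+ (u.2 %/ d) else 0)).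
  under [RHS]eq_bigr => j _ do rewrite rmorphD hornerD mulrDl.
  rewrite big_split /= -HP' big_cons addrC; congr (_ + _).
  rewrite (bigD1 j0) //= eqxx [X in _ = _ + X]big1 ?addr0; last first.
    by move=> j /negbTE->; rewrite rmorph0 horner0 mul0r.
  rewrite rmorphM !rmorphXn /= map_polyX hornerM !horner_exp hornerX -Hk -ald.
  by rewrite -mulrA -exprM -exprD mulnC -divn_eq.
pose len j := root1_length (P j)^z.[w].
have gen j : root1_gen (P j)^z.[w] by apply: root1_gen_horner; exact: root1_prim pw.
exists (\sum_j len j)%N.
  rewrite gP; apply: (@big_rec2 _ _ (radical_sum al N)) => [|j l' x _ [t [st ht ->]]].
    by exists [::]; rewrite big_nil.
  have [t' [st' ht' xE]] := root1_gen_length (gen j).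
  exists ([seq (u, j : nat) | u <- t'] ++ t); split.
  - by rewrite size_cat size_map st' st.
  - move=> u; rewrite mem_cat => /orP[/mapP[v vt ->]|/ht //].
    by split; [exact: ht' | exact: leq_trans (ltn_ord j) dN].
  - by rewrite big_cat big_map xE mulr_suml.
have nc_gt0 : 0 < (num_conj n)%:R :> C by rewrite ltr0n num_conj_gt0.
rewrite -(ler_pM2l nc_gt0).
have : \sum_j sum_conj_sq n w (P j) <= (num_conj n)%:R * H ^+ 2.
  apply: (sum_conj_sq_radical_le pw d0 dn GA A0 H0) => r x co xd.
  apply: Hle => q; rewrite gP; exact: root_conj_radical pw d0 dn al0 ald al_e co xd.
apply: le_trans; rewrite mulrCA.
apply: (@le_trans _ _ (\sum_j 2^-1 ^+ Y * ((num_conj n)%:R * h (len j)))).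
  rewrite -!mulr_sumr !ler_wpM2l ?exprn_ge0 ?invr_ge0 ?ler0n //.
  exact: length_bound_sum hY.
apply: ler_sum => j _.
have := sum_conj_sq_ge (P j) hY pw.
apply: le_trans; rewrite -mulrA ler_wpM2r ?mulr_ge0 ?ler0n ?(length_bound_ge0 hY) //.
apply: ler_wiXn2l; rewrite ?invr_ge0 ?invf_le1 ?ler1n ?ltr0n ?ler0n //.
exact: small_primes_le.
Qed.
End MeanSquareRadical.

(** * The choice of the exponent *)

Section Analysis.
Variable R : realType.
Implicit Types (k t u eta : R).

Lemma powR_subadd eta t u : 0 < eta < 1 -> 0 <= t -> 0 <= u ->
  (t + u) `^ (1 - eta) <= t `^ (1 - eta) + u `^ (1 - eta).
Proof.
move=> /andP[eta0 eta1] t0 u0; have e1 : 0 < 1 - eta by rewrite subr_gt0.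
have [v0|v0] := eqVneq (t + u) 0.
  by rewrite v0 powR0 ?gt_eqF // addr_ge0 ?powR_ge0.
have v_gt0 : 0 < t + u by rewrite lt_def v0 addr_ge0.
have part x : 0 <= x -> x <= t + u -> x / (t + u) * (t + u) `^ (1 - eta) <= x `^ (1 - eta).
  move=> x0 xv; rewrite -[x in leRHS](divfK v0) powRM ?divr_ge0 ?(ltW v_gt0) //.
  rewrite ler_wpM2r ?powR_ge0 //; have [->|xn0] := eqVneq x 0.
    by rewrite mul0r powR_ge0.
  apply: ger1_powR; last by rewrite lerBlDr lerDl ltW.
  have x_gt0 : 0 < x by rewrite lt_def xn0.
  by apply/andP; split; [exact: divr_gt0 | rewrite ler_pdivrMr // mul1r].
rewrite -[leLHS]mul1r -[X in X * _ <= _](divff v0) mulrDl mulrDl.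
by apply: lerD; apply: part; rewrite ?lerDl ?lerDr.
Qed.

Lemma powR_1B_expR eta t : 0 < t -> t `^ (1 - eta) = t * expR (eta * - ln t).
Proof.
move=> t0; rewrite /powR gt_eqF // mulrBl mul1r expRD lnK ?posrE //.
by rewrite mulrN.
Qed.

Definition free_exponent (Y : nat) eta := 0 < eta < 1 /\
  forall p, prime p -> (Y <= p)%N -> metric_bound (fun n => n%:R `^ (1 - eta) : R) p.

Lemma large_prime_metric eta theta B (p : nat) :
  (1 < p)%N -> 0 < eta < 1 -> 0 < theta ->
  2 <= B -> 2 * p%:R - 2 <= (p%:R - 2) * B ->
  B <= expR (eta * (theta * ln p%:R)) -> ln 2 <= theta * ln p%:R ->
  3 <= expR ((1 - theta) * ln p%:R) * (eta * ln 2) ->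
  metric_bound (fun n => n%:R `^ (1 - eta) : R) p.
Proof.
move=> p1 /andP[eta0 eta1] th0 B2 pB Bp lnp p3 n d dC dtri dn.
have e1 : 0 < 1 - eta by rewrite subr_gt0.
have p0 : (0 < p)%N by apply: ltnW.
have pR0 : 0 < p%:R :> R by rewrite ltr0n.
have [n0|n_gt0] := posnP n.
  rewrite n0 powR0 ?gt_eqF // mulr0 sumr_ge0 // => j _.
  by rewrite sumr_ge0 // => i _; exact: powR_ge0.
have nR0 : 0 < n%:R :> R by rewrite ltr0n.
pose x i j : R := (d i j)%:R / n%:R.
have xE i j : (d i j)%:R `^ (1 - eta) = x i j `^ (1 - eta) * n%:R `^ (1 - eta).
  by rewrite -powRM ?divr_ge0 ?ler0n // divfK ?gt_eqF.
under eq_bigr => j _.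
  under eq_bigr => i _ do rewrite xE.
  rewrite -mulr_suml; over.
rewrite -mulr_suml ler_wpM2r ?powR_ge0 //.
pose tau := expR (- (theta * ln p%:R)).
have tau_half : tau <= 2^-1.
  by rewrite -[2^-1]lnK ?posrE ?invr_gt0 // lnV ?posrE // ler_expR lerN2.
have mono a b : 0 <= a -> a <= b -> a `^ (1 - eta) <= b `^ (1 - eta).
  move=> a0 ab; apply: ge0_ler_powR; rewrite ?(ltW e1) ?nnegrE //.
  exact: le_trans a0 ab.
apply: (@sum_concave_pseudometric R p (fun t => t `^ (1 - eta)) B tau x) => //.
- exact: expR_ge0.
- by move=> t u t0 u0; apply: powR_subadd => //; rewrite eta0.
- move=> t t0; have [t1|t1] := leP t 1.
    have [->|tn0] := eqVneq t 0; first exact: powR_ge0.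
    by apply: ger1_powR; rewrite ?lerBlDr ?lerDl ?(ltW eta0) // t1 lt_def tn0 t0.
  have : 1 `^ (1 - eta) = 1 :> R by rewrite powR1.
  by move=> h1; rewrite -[leLHS]h1; apply: mono => //; exact: ltW.
- move=> t t0 ttau; have [->|tn0] := eqVneq t 0; first by rewrite mulr0 powR_ge0.
  have t_gt0 : 0 < t by rewrite lt_def tn0.
  rewrite powR_1B_expR // mulrC ler_wpM2l // (le_trans Bp) // ler_expR.
  rewrite ler_wpM2l ?(ltW eta0) // lerNr -[leRHS]expRK.
  by rewrite ler_ln ?posrE ?expR_gt0.
- move=> t tau_t; set m := Num.min t 2^-1.
  have t0 : 0 < t := le_lt_trans (expR_ge0 _) tau_t.
  have m0 : 0 < m by rewrite lt_min t0 /= invr_gt0 ltr0n.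
  have tau_m : tau <= m by rewrite le_min tau_half (ltW tau_t).
  apply: (@le_trans _ _ (m `^ (1 - eta))); last first.
    by apply: mono; [exact: ltW | rewrite ge_min lexx].
  rewrite powR_1B_expR //.
  have lnm : ln 2 <= - ln m.
    rewrite lerNr -lnV ?posrE // ler_ln ?posrE ?invr_gt0 //.
    by rewrite ge_min lexx orbT.
  apply: (@le_trans _ _ (m * (1 + eta * ln 2))); last first.
    rewrite ler_wpM2l ?(ltW m0) // (le_trans _ (expR_ge1Dx _)) // lerD2l.
    by rewrite ler_wpM2l // ltW.
  rewrite mulrDr mulr1 lerD2l ler_pdivrMr //.
  have ln2 : 0 < ln 2 :> R by rewrite ln_gt0 // ltr1n.
  apply: le_trans p3 _; rewrite mulrAC ler_wpM2r ?mulr_ge0 ?(ltW eta0) ?(ltW ln2) //.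
  apply: (@le_trans _ _ (tau * p%:R)); last by rewrite ler_wpM2r ?ler0n.
  by rewrite -[p%:R in leRHS](lnK (_ : p%:R \in Num.pos)) ?posrE // -expRD mulrBl mul1r addrC.
- by move=> i j; rewrite divr_ge0 ?ler0n.
- by move=> i j; rewrite /x dC.
- by move=> i j l; rewrite /x -mulrDl -natrD ler_wpM2r ?invr_ge0 ?ler0n // ler_nat.
- move=> j; rewrite -mulr_suml ler_pdivlMr // mul1r -natr_sum ler_nat; exact: dn.
Qed.

Lemma free_exponent_large k : ln 2 < k -> exists L0 : R, 0 < L0 /\
  forall Y : nat, (0 < Y)%N -> L0 <= ln Y%:R -> free_exponent Y (k / ln Y%:R).
Proof.
move=> hk; have ln2 : 0 < ln 2 :> R by rewrite ln_gt0 // ltr1n.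
have k0 : 0 < k := lt_trans ln2 hk.
pose theta := (ln 2 / k + 1) / 2.
have q1 : ln 2 / k < 1 by rewrite ltr_pdivrMr // mul1r.
have q0 : 0 < ln 2 / k by rewrite divr_gt0.
have th0 : 0 < theta by rewrite /theta; lra.
have th1 : theta < 1 by rewrite /theta; lra.
have kth : ln 2 < k * theta.
  by rewrite -ltr_pdivrMl // mulrC /theta; lra.
pose B := expR (k * theta).
have B2 : 2 < B by rewrite -[X in X < _]lnK ?posrE // ltr_expR.
pose c1 := 2 / (B - 2); pose c2 := 12 / ((1 - theta) ^+ 2 * (k * ln 2)).
have c1_gt0 : 0 < c1 by rewrite divr_gt0 // subr_gt0.
have den0 : 0 < (1 - theta) ^+ 2 * (k * ln 2).
  by rewrite !mulr_gt0 // subr_gt0.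
have c2_gt0 : 0 < c2 by rewrite divr_gt0.
exists (k + 1 + c1 + c2); split; first by rewrite !addr_gt0.
move=> Y Y0; set U := ln Y%:R => HU.
have YR0 : 0 < Y%:R :> R by rewrite ltr0n.
have kU : k < U by lra.
have U0 : 0 < U by lra.
have eta01 : 0 < k / U < 1 by rewrite divr_gt0 //= ltr_pdivrMr // mul1r.
split=> // p pp Yp; have pR0 : 0 < p%:R :> R by rewrite ltr0n prime_gt0.
have Up : U <= ln p%:R by rewrite ler_ln ?posrE // ler_nat.
apply: (@large_prime_metric _ theta B) => //; rewrite ?(ltW B2) ?prime_gt1 //.
- have : 2 + c1 <= p%:R.
    apply: (@le_trans _ _ (1 + U)); first by lra.
    rewrite -[leRHS](lnK (_ : p%:R \in Num.pos)) ?posrE //.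
    by apply: le_trans (expR_ge1Dx _) _; rewrite ler_expR.
  have : c1 * (B - 2) = 2 by rewrite divfK // gt_eqF // subr_gt0.
  have : 0 < B - 2 by rewrite subr_gt0.
  nra.
- rewrite ler_expR; apply: (@le_trans _ _ (k / U * (theta * U))).
    by rewrite [leRHS](_ : _ = k * theta) //; field; rewrite gt_eqF.
  apply: ler_wpM2l; first by rewrite divr_ge0 // ltW.
  by apply: ler_wpM2l Up; exact: ltW.
- apply: (@le_trans _ _ (theta * k)); first by rewrite mulrC ltW.
  by rewrite ler_wpM2l ?(ltW th0) //; lra.
have t1 : 0 < 1 - theta by rewrite subr_gt0.
have kln : 0 <= k / U * ln 2 by rewrite mulr_ge0 ?divr_ge0 ?ltW.
apply: (@le_trans _ _ (((1 - theta) * U) ^+ 2 / 2 * (k / U * ln 2))); last first.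
  rewrite ler_wpM2r //; apply: (@le_trans _ _ (expR ((1 - theta) * U))).
    have x0 : 0 <= (1 - theta) * U by rewrite mulr_ge0 // ltW.
    by apply: le_trans (expR_ge1Dxn 1 x0); rewrite lerDr.
  by rewrite ler_expR ler_wpM2l // ltW.
have -> : ((1 - theta) * U) ^+ 2 / 2 * (k / U * ln 2) =
    U * ((1 - theta) ^+ 2 * (k * ln 2)) / 2 by field; rewrite gt_eqF.
have : c2 <= U by lra.
rewrite /c2 ler_pdivrMr // => h; lra.
Qed.
End Analysis.

Section Choice.
Variable R : realType.

Lemma half_exp_ge (Y : nat) : expR (- Y%:R) <= 2^-1 ^+ Y :> R.
Proof.
rewrite -[- Y%:R]mulr1 mulNr -mulrN expRM_natl; apply: lerXn2r.
- by rewrite nnegrE expR_ge0.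
- by rewrite nnegrE invr_ge0.
rewrite expRN lef_pV2 ?posrE ?expR_gt0 //.
by have := @expR_ge1Dx R 1.
Qed.

Lemma exponent_choice (k : R) : ln 2 < k -> exists c : R, 0 < c /\
  forall n, (2 <= n)%N -> exists Y eta, free_exponent Y eta /\
    c * n%:R * expR (- (k * ln n%:R / ln (ln n%:R))) <= 2^-1 ^+ Y * n%:R `^ (1 - eta).
Proof.
move=> hk; have ln2 : 0 < ln 2 :> R by rewrite ln_gt0 // ltr1n.
pose k1 := (ln 2 + k) / 2; pose k2 := (k1 + k) / 2.
have hk1 : ln 2 < k1 by rewrite /k1; lra.
have k12 : k1 < k2 by rewrite /k2 /k1; lra.
have k2k : k2 < k by rewrite /k2 /k1; lra.
have k1_gt0 : 0 < k1 := lt_trans ln2 hk1.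
have k2_gt0 : 0 < k2 := lt_trans k1_gt0 k12.
have [L0 [L0_gt0 HL0]] := free_exponent_large hk1.
pose sig := k1 / k2.
have sig0 : 0 < sig by rewrite divr_gt0.
have sig1 : sig < 1 by rewrite ltr_pdivrMr // mul1r.
pose c1 := 4 / ((1 - sig) ^+ 2 * (k - k2)).
have den0 : 0 < (1 - sig) ^+ 2 * (k - k2) by apply: mulr_gt0; rewrite ?exprn_gt0 ?subr_gt0.
have c1_gt0 : 0 < c1 by rewrite divr_gt0.
pose L1 := L0 / sig + c1; have L1_gt0 : 0 < L1 by apply: addr_gt0 => //; apply: divr_gt0.
pose f (n : nat) : R := n%:R * expR (- (k * ln n%:R / ln (ln n%:R))).
have f0 n : 0 <= f n by rewrite mulr_ge0 ?ler0n ?expR_ge0.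
pose m := (Num.truncn (expR (expR L1))).+1; pose Z := \sum_(i < m) f i.
have Z0 : 0 <= Z by apply: sumr_ge0.
pose Y0 := (Num.truncn (expR L0)).+1.
have Y0L : L0 <= ln Y0%:R.
  rewrite -[leLHS]expRK ler_ln ?posrE ?expR_gt0 ?ltr0n //.
  by have /andP[_ /ltW] := truncn_itv (expR_ge0 L0).
have free0 := HL0 Y0 isT Y0L.
have half0 j : 0 < 2^-1 ^+ j :> R by rewrite exprn_gt0 // invr_gt0.
pose c0 := 2^-1 ^+ Y0 / (Z + 1); have Z1 : 0 < Z + 1 by rewrite ltr_wpDl.
exists (Num.min 1 c0); split; first by rewrite lt_min ltr01 divr_gt0.
move=> n n2; rewrite -mulrA -/(f n).
have n_gt0 : 0 < n%:R :> R by rewrite ltr0n (leq_trans _ n2).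
have n1 : 1 < n%:R :> R by rewrite ltr1n.
have lnn : 0 < ln n%:R :> R by rewrite ln_gt0.
have [big|small] := leP L1 (ln (ln n%:R)); last first.
  exists Y0, (k1 / ln Y0%:R); split=> //.
  have n_lt : (n < m)%N.
    rewrite -(ltr_nat R); have /andP[_] := truncn_itv (expR_ge0 (expR L1)).
    apply: lt_trans; rewrite -[ltLHS]lnK ?posrE // ltr_expR.
    by rewrite -[ltLHS]lnK ?posrE // ltr_expR.
  have fZ : f n <= Z + 1.
    rewrite /Z (bigD1 (Ordinal n_lt)) //= -addrA lerDl addr_ge0 //.
    exact: sumr_ge0.
  apply: (@le_trans _ _ (c0 * (Z + 1))).
    by rewrite ler_pM ?le_min ?ler01 ?divr_ge0 ?(ltW Z1) ?(ltW (half0 _)) // ge_min lexx orbT.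
  rewrite divfK ?gt_eqF // -[leLHS]mulr1 ler_pM2l //.
  have /andP[_ e1] := proj1 free0.
  by rewrite -[leLHS](powRr0 n%:R) ler_powR ?(ltW n1) // subr_ge0 ltW.
set L := ln (ln n%:R) in big *.
have L_gt0 : 0 < L by lra.
have lnE : ln n%:R = expR L by rewrite lnK.
pose Y := (Num.truncn (expR (sig * L))).+1.
have /andP[Y_lo Y_hi] := truncn_itv (expR_ge0 (sig * L)).
have YL : sig * L <= ln Y%:R.
  by rewrite -[leLHS]expRK ler_ln ?posrE ?expR_gt0 ?ltr0n // ltW.
have L0Y : L0 <= ln Y%:R.
  apply: le_trans YL; rewrite mulrC -ler_pdivrMr //.
  by apply: le_trans big; rewrite lerDl ltW.
exists Y, (k1 / ln Y%:R); split; first exact: HL0.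
apply: (@le_trans _ _ (1 * f n)); first by rewrite ler_wpM2r // ge_min lexx.
rewrite mul1r powR_1B_expR // mulrCA ler_wpM2l ?ler0n //.
apply: (@le_trans _ _ (expR (- Y%:R) * expR (k1 / ln Y%:R * - ln n%:R))); last first.
  by rewrite ler_wpM2r ?expR_ge0 // half_exp_ge.
rewrite -expRD ler_expR mulrN -opprD lerN2 lnE expRK.
have eL : 0 < expR L := expR_gt0 L.
have sL : 0 < sig * L by rewrite mulr_gt0.
have a1 : k1 / ln Y%:R * expR L <= k2 * expR L / L.
  rewrite [leRHS]mulrAC ler_wpM2r ?(ltW eL) //.
  apply: (@le_trans _ _ (k1 / (sig * L))).
    by rewrite ler_wpM2l ?(ltW k1_gt0) // lef_pV2 ?posrE // (lt_le_trans sL).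
  by rewrite /sig le_eqVlt; apply/orP; left; apply/eqP; field; rewrite !gt_eqF.
have a2 : Y%:R <= 2 * expR (sig * L).
  have : 1 <= expR (sig * L) by rewrite -expR0 ler_expR ltW.
  by rewrite /Y -natr1; lra.
have a3 : 2 * expR (sig * L) <= (k - k2) * expR L / L.
  rewrite ler_pdivlMr //.
  have -> : expR L = expR (sig * L) * expR ((1 - sig) * L).
    by rewrite -expRD; congr expR; ring.
  have x0 : 0 <= (1 - sig) * L by rewrite mulr_ge0 ?(ltW L_gt0) // subr_ge0 ltW.
  have := expR_ge1Dxn 1 x0; have : c1 <= L.
    by apply: le_trans big; rewrite lerDr divr_ge0 // ltW.
  rewrite ler_pdivrMr // => h1 h2.
  have h3 : 2 * L <= (k - k2) * expR ((1 - sig) * L).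
    have kk : 0 <= k - k2 by rewrite subr_ge0 ltW.
    have : (k - k2) * (((1 - sig) * L) ^+ 2 / 2) <= (k - k2) * expR ((1 - sig) * L).
      by rewrite ler_wpM2l //; apply: le_trans h2; rewrite lerDr.
    apply: le_trans.
    have -> : (k - k2) * (((1 - sig) * L) ^+ 2 / 2) =
       L * (L * ((1 - sig) ^+ 2 * (k - k2))) / 2 by field.
    have : L * 4 <= L * (L * ((1 - sig) ^+ 2 * (k - k2))) by rewrite ler_wpM2l // ltW.
    lra.
  have : expR (sig * L) * (2 * L) <= expR (sig * L) * ((k - k2) * expR ((1 - sig) * L)).
    by rewrite ler_wpM2l ?expR_ge0.
  by rewrite mulrA mulrCA [_ * 2]mulrC.
have -> : k * expR L / L = (k - k2) * expR L / L + k2 * expR L / L by field; rewrite gt_eqF.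
lra.
Qed.
End Choice.

(** * The house *)

Section House.
Variable R : realType.
Implicit Types (x y : R[i]) (p q : {poly rat}).

Notation "Q ^q" := (map_poly (ratr : rat -> R[i]) Q) (at level 1, format "Q ^q").

Lemma norm_normc x : `|x| = (Normc.normc x)%:C%C.
Proof. by rewrite normc_def; case: x. Qed.

Lemma normc_ge0 x : 0 <= Normc.normc x.
Proof. by rewrite -lecR -norm_normc normr_ge0. Qed.

Lemma minimal_polynomial x : algebraic_integer x ->
  exists p, [/\ p \is monic, irreducible_poly p, root p^q x &
    forall q, root q^q x -> p %| q].
Proof.
move=> [P P_monic Px].
have ex : exists n, `[< exists q, [/\ q != 0, root q^q x & size q = n] >].
  exists (size (map_poly (intr : int -> rat) P)); apply/asboolP.
  exists (map_poly intr P); rewrite map_poly_int_rat; split=> //.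
  by rewrite map_poly_eq0_id0 ?intr_eq0 ?lead_coef_eq0 ?monic_neq0.
case: (ex_minnP ex) => n /asboolP[p0 [p0n0 p0x size_p0]] n_min.
pose p := (lead_coef p0)^-1 *: p0.
have lc0 : (lead_coef p0)^-1 != 0 by rewrite invr_eq0 lead_coef_eq0.
have p_monic : p \is monic by rewrite monicE lead_coefZ mulVf // lead_coef_eq0.
have px : root p^q x by rewrite map_polyZ rootZ // fmorph_eq0.
have p_min q : q != 0 -> root q^q x -> (size p <= size q)%N.
  move=> qn0 qx; rewrite size_scale // size_p0; apply: n_min.
  by apply/asboolP; exists q.
have p_size : (1 < size p)%N.
  rewrite -(size_map_poly (ratr : rat -> R[i])); apply: root_size_gt1 px.
  by rewrite map_poly_eq0 monic_neq0.
have p_dvd q : root q^q x -> p %| q.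
  move=> qx; rewrite /dvdp; apply: contraT => rn0.
  have : root (q %% p)^q x.
    move: qx; rewrite !rootE {1}(divp_eq q p) rmorphD rmorphM /= hornerD hornerM.
    by rewrite (eqP (px : _ == 0)) mulr0 add0r.
  by move/(p_min _ rn0); rewrite leqNgt ltn_modp monic_neq0.
exists p; split=> //; split=> // q sq /dvdpP[r pE].
have : root (r * q)^q x by rewrite -pE.
rewrite rmorphM rootM => /orP[rx|qx].
  have qn0 : q != 0 by apply: contraTneq p_size => q0; rewrite pE q0 mulr0 size_poly0.
  have rn0 : r != 0 by apply: contraTneq p_size => r0; rewrite pE r0 mul0r size_poly0.
  have := p_min _ rn0 rx; rewrite pE size_mul //.
  move: sq qn0; rewrite -size_poly_gt0; case: (size q) => [|[|m]] // _ _.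
  by rewrite addnS /= addnS ltnNge leq_addr.
have qp : q %| p by apply/dvdpP; exists r.
by rewrite /eqp qp p_dvd.
Qed.

Lemma house_ge x y : algebraic_integer x -> conjugates x y -> Normc.normc y <= house x.
Proof.
move=> /minimal_polynomial[p [p_monic p_irr px p_dvd]] xy.
apply: sup_upper_bound; last by exists y.
split; first by exists (Normc.normc y), y.
have [r rE] := closed_field_poly_normal p^q.
exists (\sum_(u <- r) Normc.normc u) => _ [u [q [q_monic q_irr qx qu]] <-].
have : root p^q u.
  have /eqp_root : p^q %= q^q.
    rewrite eqp_map; apply: q_irr.2; last exact: p_dvd.
    by rewrite gtn_eqF // p_irr.1.
  by move=> ->.
rewrite rE rootZ ?lead_coef_eq0 ?map_poly_eq0 ?monic_neq0 // root_prod_XsubC => ur.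
rewrite (big_rem u) //= lerDl; apply: sumr_ge0 => v _; exact: normc_ge0.
Qed.

Lemma conjugates_refl x : algebraic_integer x -> conjugates x x.
Proof. by move=> /minimal_polynomial[p [? ? ? _]]; exists p; split. Qed.

Lemma Delta_rational a N (z : R[i]) : exists delta : rat, (Delta a N z)%:C%C = ratr delta.
Proof.
rewrite /Delta; case: (a == 1%N); first by exists 1; rewrite !rmorph1.
set x := \prod_(p <- _) _; rewrite -norm_normc.
suff [q ->] : exists q : rat, field_norm (Qfield R) (Qa R a N) x = ratr q.
  by exists `|q|; rewrite -ratr_norm.
rewrite /field_norm; case: xgetP => [t _ [n [A [[b [_ A_rat _]] ->]]]|_]; last first.
  by exists 0; rewrite rmorph0.
have /choice[f fE] : forall ij : 'I_n * 'I_n, exists q : rat, ratr q = A ij.1 ij.2.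
  by move=> [i j]; have [q _ <-] := A_rat i j; exists q.
exists (\det (\matrix_(i, j) f (i, j))); rewrite -det_map_mx; congr (\det _).
apply/matrixP => i j; rewrite !mxE; exact: esym (fE (i, j)).
Qed.

Lemma sum_of_termsP a N (x : R[i]) n : (0 < N)%N ->
  sum_of_terms a N x n <-> radical_sum (N.-root a%:R) N x n.
Proof.
move=> N0; have rootX j : N.-root (a%:R ^+ j) = N.-root a%:R ^+ j :> R[i].
  by rewrite rootCX ?ler0n.
split=> [[xi [j [hxi ->]]]|[s [<- hs ->]]].
  exists [seq (xi i, j i : nat) | i <- enum 'I_n]; split.
  - by rewrite size_map size_enum_ord.
  - move=> u /mapP[i _ ->]; split=> //=.
    by have [m m0 hm] := hxi i; exists m => //; apply/eqP; rewrite -unity_rootE.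
  - by rewrite big_map big_enum; apply: eq_bigr => i _; rewrite rootX.
pose x0 : (R[i] * nat)%type := (0, 0%N).
have hs' (i : 'I_(size s)) : root1 (nth x0 s i).1 /\ ((nth x0 s i).2 < N)%N.
  by apply: hs; rewrite mem_nth.
exists (fun i => (nth x0 s i).1), (fun i => Ordinal (proj2 (hs' i))); split.
  by move=> i; have [[m m0 xm] _] := hs' i; exists m => //; rewrite unity_rootE xm.
rewrite (big_nth x0) big_mkord; apply: eq_bigr => i _.
by rewrite rootX.
Qed.
End House.

Theorem theorem1p1 (R : realType) (k : R) (hk : ln 2 < k) :
  exists c : R, 0 < c /\
    forall (a : nat), (0 < a)%N -> a = 1%N \/ not_perfect_power a ->
    forall (N : nat), (1 <= N)%N ->
    forall (z : R[i]), N.-primitive_root z ->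
    forall (beta : R[i]), Qa R a N beta -> algebraic_integer beta ->
    Mlength a N z beta <> 0%N -> Mlength a N z beta <> 1%N ->
    let M : R := (Mlength a N z beta)%:R in
    Delta a N z ^+ 2 * house beta ^+ 2
      >= c * M * expR (- (k * ln M / ln (ln M))).
Proof.
have [c [c0 Hc]] := exponent_choice hk; exists c; split=> // a a0 npp N N0 z _ beta _ beta_int.
set l := Mlength a N z beta => l0 l1 /=.
have l2 : (2 <= l)%N by case: (l) l0 l1 => [|[|]].
have [Y [eta [[/andP[eta0 eta1] metric] le_c]]] := Hc l l2.
apply: le_trans le_c _.
set D := Delta a N z; pose g := D%:C%C * beta.
have [g_l l_min] : sum_of_terms a N g l /\ forall m, sum_of_terms a N g m -> (l <= m)%N.
  move: l0; rewrite /l /Mlength -/D -/g.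
  by case: xgetP => [y _ []|] //.
have D_ge0 : 0 <= D.
  by rewrite /D /Delta; case: ifP => // _; exact: normc_ge0.
have Dn0 : D%:C%C != 0 :> R[i].
  apply/eqP => D0; have g0 : g = 0 by rewrite /g D0 mul0r.
  have : (l <= 0)%N.
    apply: l_min; rewrite g0.
    have [t j] : (('I_0 -> R[i]) * ('I_0 -> 'I_N))%type by split; case.
    by exists t, j; split; [case | rewrite big_ord0].
  by rewrite leqn0 => /eqP.
have [delta deltaE] := Delta_rational a N z; rewrite -/D in deltaE.
have [p [p_monic p_irr p_beta _]] := minimal_polynomial beta_int.
have house0 : 0 <= house beta.
  exact: le_trans (normc_ge0 beta) (house_ge beta_int (conjugates_refl beta_int)).
pose H : R[i] := (D * house beta)%:C%C.
have H0 : 0 <= H by rewrite ler0c mulr_ge0.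
have conj_le g' : (forall q, root (map_poly ratr q) g -> root (map_poly ratr q) g') -> `|g'| <= H.
  move=> g'g; pose q := p \Po (delta^-1 *: 'X).
  have qE x : (map_poly ratr q).[x] = (map_poly ratr p).[(D%:C%C)^-1 * x].
    by rewrite map_comp_poly horner_comp map_polyZ map_polyX hornerZ hornerX fmorphV deltaE.
  have : root (map_poly ratr q) g' by apply: g'g; rewrite rootE qE mulKf.
  rewrite rootE qE => rg'.
  have : Normc.normc ((D%:C%C)^-1 * g') <= house beta.
    by apply: house_ge => //; exists p; split.
  rewrite -lecR -norm_normc normrM normfV norm_normc => h.
  rewrite /H rmorphM /=.
  have -> : D%:C%C = `|D%:C%C| :> R[i] by rewrite ger0_norm // ler0c.
  rewrite mulrC -ler_pdivrMr ?normr_gt0 // mulrC.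
  by move: h; rewrite -norm_normc.
pose h (n : nat) : R[i] := (n%:R `^ (1 - eta))%:C%C.
have e1 : 0 < 1 - eta by rewrite subr_gt0.
have h_mono n m : (n <= m)%N -> h n <= h m.
  move=> nm; rewrite lecR; apply: ge0_ler_powR; rewrite ?(ltW e1) ?nnegrE ?ler0n //.
  by rewrite ler_nat.
have hY : length_bound h Y.
  split=> //.
  - by move=> n; rewrite ler0c powR_ge0.
  - move=> n m; rewrite -rmorphD lecR natrD; apply: powR_subadd; rewrite ?ler0n //.
    by rewrite eta0.
  - by rewrite /h powR0 ?gt_eqF.
  - move=> [|n]; first by rewrite /h powR0 ?gt_eqF.
    have -> : n.+1%:R = (n.+1%:R)%:C%C :> R[i] by rewrite rmorph_nat.
    by rewrite lecR ler1_powR ?ler1n // lerBlDr lerDl ltW.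
  - move=> q pq Yq n d dC dtri dn.
    have := metric q pq Yq n d dC dtri dn; rewrite -lecR !rmorphM rmorphB rmorph1 !rmorph_nat.
    rewrite rmorph_sum /=; under [X in _ <= X -> _]eq_bigr do rewrite rmorph_sum; exact.
have [] := @radical_sum_bound R[i] h Y a N l (N.-root a%:R) g H hY a0 npp N0.
- by rewrite rootC_gt0 // ltr0n.
- by rewrite rootCK.
- exact/sum_of_termsP.
- exact: H0.
- exact: conj_le.
move=> l' /(sum_of_termsP _ _ _ N0)/l_min ll'.
have -> : 2^-1 ^+ Y * h l' = (2^-1 ^+ Y * l'%:R `^ (1 - eta))%:C%C.
  by rewrite rmorphM rmorphXn fmorphV rmorph_nat.
rewrite -rmorphXn lecR exprMn; apply: le_trans.
rewrite ler_wpM2l ?exprn_ge0 ?invr_ge0 //.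
by have := h_mono _ _ ll'; rewrite lecR.
Qed.
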